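(* Let $S$ be a square. Up to symmetries of $S$, there is only one proper perfect Mondrian $7$-partition of $S$ (that is, such a partition exists, and any two such partitions are related by a symmetry of $S$).
   Context: All rectangles have real side lengths. Two rectangles are congruent, written $R_1\cong R_2$, if the lengths of their sides (not necessarily in the same order) are equal. A $k$-partition ($k\ge 2$) of a rectangle $R$ is a tiling of $R$ by $k$ rectangles $R_1,\dots,R_k$. A partition $\{R_1,\dots,R_k\}$ of $R$ is a Mondrian partition if $R_i\not\cong R_j$ for all $i\ne j$. A Mondrian partition is perfect if $\mathrm{area}(R_i)=\frac1k\,\mathrm{area}(R)$ for every $i$. A partition $\mathcal{P}=\{R_1,\dots,R_k\}$ of $R$ is proper if there is no subset $\mathcal{P}'\subset\mathcal{P}$ with $1<|\mathcal{P}'|<k$ whose members form (i.e., have union equal to) a rectangle $R'$ contained in $R$. ''Up to symmetries'' means that partitions obtained from each other by a symmetry (rotation or reflection) of the square are identified. *)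

(* Defs.v *)
From HB Require Import structures.
From mathcomp Require Import all_boot all_order all_algebra.
From mathcomp Require Import all_classical all_reals all_analysis.
Import Order.TTheory GRing.Theory Num.Theory.
Import numFieldNormedType.Exports.

Set Implicit Arguments.
Unset Strict Implicit.
Unset Printing Implicit Defensive.

Local Open Scope classical_set_scope.
Local Open Scope ring_scope.

(* Non-degenerate closed rectangles of the plane, in coordinates whose axes are
   parallel to the sides of the rectangle being tiled. *)
Record rectangle (R : realType) := Rectangle {
  xmin : R;
  xmax : R;
  ymin : R;
  ymax : R;
  xmin_lt_xmax : xmin < xmax;
  ymin_lt_ymax : ymin < ymax
}.

Definition region (R : realType) (r : rectangle R) : set (R * R) :=
  `[xmin r, xmax r] `*` `[ymin r, ymax r].

Definition width (R : realType) (r : rectangle R) : R := xmax r - xmin r.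

Definition height (R : realType) (r : rectangle R) : R := ymax r - ymin r.

Definition area (R : realType) (r : rectangle R) : R := width r * height r.

Definition is_square (R : realType) (r : rectangle R) : Prop :=
  width r = height r.

Definition congruent (R : realType) (r1 r2 : rectangle R) : Prop :=
  (width r1 = width r2 /\ height r1 = height r2) \/
  (width r1 = height r2 /\ height r1 = width r2).

(* A partition {R_1, ..., R_k} is given by an enumeration P of its tiles. It has
   exactly k tiles: tiles have non-empty interior, so trivIset makes P
   injective. *)
Definition is_partition (R : realType) (k : nat) (S : rectangle R)
    (P : 'I_k -> rectangle R) : Prop :=
  [/\ (2 <= k)%N,
      \bigcup_i region (P i) = region S &
      trivIset setT (fun i => (region (P i))°)].

Definition mondrian (R : realType) (k : nat) (P : 'I_k -> rectangle R) : Prop :=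
  forall i j, i != j -> ~ congruent (P i) (P j).

Definition perfect (R : realType) (k : nat) (S : rectangle R)
    (P : 'I_k -> rectangle R) : Prop :=
  forall i, area (P i) = k%:R^-1 * area S.

Definition proper_partition (R : realType) (k : nat) (S : rectangle R)
    (P : 'I_k -> rectangle R) : Prop :=
  ~ exists (I : {set 'I_k}) (r : rectangle R),
      [/\ (1 < #|I| < k)%N,
          region r `<=` region S &
          \bigcup_(i in [set` I]) region (P i) = region r].

Definition proper_perfect_mondrian (R : realType) (k : nat) (S : rectangle R)
    (P : 'I_k -> rectangle R) : Prop :=
  [/\ is_partition S P, mondrian P, perfect S P & proper_partition S P].

(* The library norm on R * R is the sup norm, hence the explicit Euclidean
   distance. *)
Definition sqdist (R : realType) (p q : R * R) : R :=
  (p.1 - q.1) ^+ 2 + (p.2 - q.2) ^+ 2.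

Definition is_symmetry (R : realType) (S : rectangle R) (f : R * R -> R * R) :
    Prop :=
  (forall p q, sqdist (f p) (f q) = sqdist p q) /\ f @` region S = region S.

(* Partitions are unordered: f maps the set of tiles of P onto that of Q,
   whatever the enumerations. *)
Definition related_by_symmetry (R : realType) (k : nat) (S : rectangle R)
    (P Q : 'I_k -> rectangle R) : Prop :=
  exists2 f : R * R -> R * R, is_symmetry S f &
    range (fun i => f @` region (P i)) = range (fun i => region (Q i)).

(* Main.v *)
From HB Require Import structures.
Require Import Defs.
From mathcomp Require Import all_boot all_order all_algebra.
From mathcomp Require Import all_classical all_reals all_analysis.
From mathcomp Require Import ring lra zify.

(** Replace every rectangle by its half-open version, closed on the left and at
    the bottom: a tiling then becomes an honest partition of the half-open
    square ([cover_inside], [partition_disjoint]), and conversely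
    ([partition_of_inside]).

    Shapes of tilings.  Any tiling can be built from the bottom up: the union of
    the tiles placed so far lies below a skyline, and the tile through the left
    end of a plateau that is lower than both its neighbours has its lower left
    corner there and does not overhang the plateau ([place_sound]).  It either
    fills the plateau or is narrower, and its top is lower than, level with or
    higher than the neighbouring plateaus.  Branching over these outcomes with
    symbolic coordinates ([run]) is a finite search covering all tilings by
    seven rectangles ([run_sound]).  A branch is cut when some of its tiles are found
    to form a rectangle.  This is detected by cancelling corners: the indicator of a
    half-open rectangle is the signed sum of the indicators of the quadrants at
    its four corners, so a set of disjoint tiles whose signed corners cancel
    down to the corners of one rectangle fills that rectangle ([is_box_sound]).
    Fourteen shapes survive, and up to the symmetries of the square they are
    only two layouts, [spiral] and [mirror] ([run_start]).

    Areas.  Every layout gives linear relations between the widths and between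
    the heights of the tiles, and all products width times height are equal.  In
    the mirror layout a monotonicity argument forces two tiles to be congruent
    ([mirror_equal_widths]), so it is not Mondrian.  In the spiral layout, in
    the unit square, the height P of the top left tile satisfies
      P (7 P - 2) (15 P^2 - 14 P + 2) = 0,
    and the inequalities of the layout leave only P = (7 - sqrt 19) / 15, which
    determines all the tiles ([spiral_solution], [spiral_unique]).  So every
    proper perfect Mondrian 7-partition is the image of one partition,
    [spiral_rect], under a symmetry of the square ([spiral_classification]), and
    it remains to check that [spiral_rect] is such a partition; the side
    lengths of its tiles are explicit and pairwise different. *)

Import Order.TTheory GRing.Theory Num.Theory.
Import numFieldNormedType.Exports.

Set Implicit Arguments.
Unset Strict Implicit.
Unset Printing Implicit Defensive.

(** * Symbolic search for the shapes of tilings *)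

(** The position of a plateau of a skyline relative to the plateau on its left.
    The first plateau of a skyline counts as [Lower]: the left side of the square
    plays the role of an infinitely high plateau. *)
Variant sign := Lower | Level | Higher.

Definition nat_of_sign (s : sign) : nat :=
  match s with Lower => 0 | Level => 1 | Higher => 2 end.

Definition sign_of_nat (n : nat) : sign :=
  match n with 0 => Lower | 1 => Level | _ => Higher end.

Lemma nat_of_signK : cancel nat_of_sign sign_of_nat.
Proof. by case. Qed.

HB.instance Definition _ := Equality.copy sign (can_type nat_of_signK).

(** Coordinates are named by natural numbers. The tile ((a, b), (c, d)) is the
    rectangle with abscissas from a to b and ordinates from c to d. *)
Definition tile := (nat * nat * (nat * nat))%type.

(** The plateau (b, h, s) ends at the abscissa b and lies at the ordinate h; it
    starts where the previous plateau of the skyline ends. *)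
Definition plateau := (nat * nat * sign)%type.

(** The tiles placed so far, the most recent first, and the skyline above them.
    The abscissas 0 and 1 and the ordinate 0 are those of the left, right and
    bottom sides of the square. *)
Definition state := (seq tile * seq plateau)%type.

Definition signs := [:: Lower; Level; Higher].

(** Whether the plateau before k is bounded on its right by something higher. *)
Definition valley (k : seq plateau) : bool :=
  if k is (_, _, s) :: _ then (if s is Higher then true else false) else true.

(** The skyline k after the plateau before it has changed: the relative position of
    its first plateau is guessed anew. *)
Definition resign (k : seq plateau) : seq (seq plateau) :=
  if k is (b, h, _) :: k' then [seq (b, h, s) :: k' | s <- signs] else [:: [::]].

(** The possible placements of a new tile on the leftmost plateau of sky that is
    lower than both its neighbours: the new tile with the new skyline. The skyline
    starts at the abscissa a, and ss lists the possible positions of the top of a tile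
    placed on its first plateau relative to what is on its left. The fresh name n
    stands for the ordinate of the top of the tile, and for the abscissa of its
    right side if the tile is narrower than the plateau. *)
Fixpoint place (n : nat) (ss : seq sign) (a : nat) (sky : seq plateau) :
    seq (tile * seq plateau) :=
  if sky is (b, h, s) :: k then
    if valley k then
      [seq ((a, n, (h, n)), (n, n, s') :: (b, h, Lower) :: k) | s' <- ss] ++
      [seq ((a, b, (h, n)), (b, n, s') :: k') | s' <- ss, k' <- resign k]
    else [seq (tk.1, (b, h, s) :: tk.2) | tk <- place n signs b k]
  else [::].

(** Fuses the first pair of neighbouring plateaus at the same ordinate, and returns
    the two names of this ordinate. *)
Fixpoint merge (sky : seq plateau) : option (seq plateau * (nat * nat)) :=
  if sky is (b, h, s) :: k then
    if k is (b', h', Level) :: k' then Some ((b', h, s) :: k', (h', h))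
    else omap (fun r => ((b, h, s) :: r.1, r.2)) (merge k)
  else None.

Definition rename (u v h : nat) : nat := if h == u then v else h.

(** Fuses two level plateaus, if there are any, and identifies the names of their
    ordinates in the whole state. *)
Definition normalize (st : state) : state :=
  if merge st.2 is Some (sky, (u, v)) then
    ([seq (t.1, (rename u v t.2.1, rename u v t.2.2)) | t <- st.1],
     [seq (e.1.1, rename u v e.1.2, e.2) | e <- sky])
  else st.

(** A tile placed on a plateau can be level with both neighbours, hence the two
    normalizations. *)
Definition extensions (st : state) : seq state :=
  [seq normalize (normalize (tk.1 :: st.1, tk.2))
     | tk <- place (size st.1).+2 [:: Lower] 0 st.2].

(** Removes the common elements of two lists, with multiplicity. *)
Fixpoint cancel_corners (p n : seq (nat * nat)) : seq (nat * nat) * seq (nat * nat) :=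
  if p is c :: p' then
    if c \in n then cancel_corners p' (rem c n)
    else let r := cancel_corners p' n in (c :: r.1, r.2)
  else ([::], n).

(** The corners at which the indicator of the quadrant of the points above and to
    the right enters the indicator of a tile with the sign plus. *)
Definition pos_corners (ts : seq tile) :=
  flatten [seq [:: (t.1.1, t.2.1); (t.1.2, t.2.2)] | t <- ts].

(** The corners which enter with the sign minus. *)
Definition neg_corners (ts : seq tile) :=
  flatten [seq [:: (t.1.1, t.2.2); (t.1.2, t.2.1)] | t <- ts].

(** Whether the corners of the tiles cancel down to those of a single rectangle. *)
Definition is_box (ts : seq tile) : bool :=
  if cancel_corners (pos_corners ts) (neg_corners ts) is
    ([:: p1; p2], [:: n1; n2])
  then perm_eq [:: n1; n2] [:: (p1.1, p2.2); (p2.1, p1.2)]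
  else false.

(** All subsets of n elements. *)
Fixpoint masks (n : nat) : seq bitseq :=
  if n is n'.+1 then [seq b :: m | b <- [:: true; false], m <- masks n']
  else [:: [::]].

(** The pairs formed by the first of n + 1 elements with each other one. *)
Definition pair_masks (n : nat) : seq bitseq :=
  [seq true :: [seq j == i | j <- iota 0 n] | i <- iota 0 n].

(** Whether the tiles selected by one of the masks form a rectangle. A
    conditional, unlike a conjunction, is evaluated lazily. *)
Definition improper (ms : seq bitseq) (ts : seq tile) : bool :=
  has (fun m => let s := mask m ts in if 1 < size s < 7 then is_box s else false) ms.

(** The names of the plateau e are among the first n, and e is not level with its
    left neighbour. *)
Definition declared (n : nat) (e : plateau) : bool :=
  [&& e.1.1 < n, e.1.2 < n & if e.2 is Level then false else true].

Definition descends (sky : seq plateau) : bool :=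
  if sky is (_, _, s) :: _ then (if s is Lower then true else false) else false.

(** An invariant of the search. It is tested by [run] instead of being proved. *)
Definition well_formed (st : state) : bool :=
  let n := (size st.1).+2 in
  [&& all (fun t : tile => [&& t.1.1 < n, t.1.2 < n, t.2.1 < n & t.2.2 < n]) st.1,
      all (declared n) st.2 &
      descends st.2].

(** The states with seven tiles and a flat skyline that can be reached from st, except
    those in which some tiles are found to form a rectangle. Before the last tile,
    only the pairs containing the most recent tile are tested. A state which is
    not well formed, or reached with no fuel left, is returned as it is; this does
    not happen from [start] with nine units of fuel. *)
Fixpoint run (fuel : nat) (st : state) : seq state :=
  if fuel isn't f.+1 then [:: st] else
  if ~~ well_formed st then [:: st] else
  if size st.1 < 7 then
    if improper (pair_masks (size st.1).-1) st.1 then [::]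
    else flatten [seq run f st' | st' <- extensions st]
  else if 1 < size st.2 then [::]
  else if improper (masks 7) st.1 then [::] else [:: st].

Definition start : state := ([::], [:: (1, 0, Lower)]).

(** * The two surviving layouts *)

(** A layout is a list of tiles whose coordinates are named 0, 1, 2, 3, 4, where 0 and 4
    are the sides of the square. In [spiral], the names increase from left to right
    and from bottom to top. *)
Definition spiral : seq tile :=
  [:: (0, 1, (0, 3)); (1, 2, (0, 2)); (2, 4, (0, 1)); (2, 3, (1, 2));
      (3, 4, (1, 4)); (1, 3, (2, 3)); (0, 3, (3, 4))].

(** The reflection of this layout in a vertical line exchanges the tiles 0 and 2, 3
    and 4, and 6 and 5. The order of the ordinates 2 and 3, which are exchanged too,
    is not determined by the layout. *)
Definition mirror : seq tile :=
  [:: (0, 1, (0, 2)); (1, 3, (0, 1)); (3, 4, (0, 3)); (1, 2, (1, 2));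
      (2, 3, (1, 3)); (2, 4, (3, 4)); (0, 2, (2, 4))].

Definition tile0 : tile := (0, 0, (0, 0)).

(** The symmetry (s, gx, gy) of the square exchanges the coordinates if s holds,
    then reverses the abscissas if gx holds and the ordinates if gy holds. *)
Definition symmetry := (bool * bool * bool)%type.

(** The effect of a symmetry on a symbolic tile. *)
Definition orient (e : symmetry) (t : tile) : tile :=
  let: (s, gx, gy) := e in
  let t := if s then (t.2, t.1) else t in
  ((if gx then (t.1.2, t.1.1) else t.1), (if gy then (t.2.2, t.2.1) else t.2)).

(** A matching (e, pi, rx, ry) says how a state realizes a layout: under the symmetry
    e, the k-th tile of the layout is the tile of index pi_k of the state, and the
    coordinates named i in the layout are those named rx_i and ry_i in the state. *)
Definition matching := (symmetry * seq nat * seq nat * seq nat)%type.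

Definition relabel (rx ry : seq nat) (t : tile) : tile :=
  ((nth 0 rx t.1.1, nth 0 rx t.1.2), (nth 0 ry t.2.1, nth 0 ry t.2.2)).

(** Whether m is a matching of the complete state st with the given layout. The square
    is treated as one more tile, (0, 1, (0, top)) in the state and
    (0, 4, (0, 4)) in the layout. *)
Definition matches (layout : seq tile) (st : state) (m : matching) : bool :=
  let: (e, pi, rx, ry) := m in
  if st.2 is [:: (1, top, Lower)] then
    [&& size st.1 == 7, perm_eq pi (iota 0 7),
        orient e (0, 1, (0, top)) == relabel rx ry (0, 4, (0, 4)) &
        [seq orient e (nth tile0 st.1 j) | j <- pi] ==
        [seq relabel rx ry t | t <- layout]]
  else false.

Definition spiral_matchings : seq matching := [::
  ((false, false, false), [:: 6; 5; 4; 3; 2; 1; 0], [:: 0; 2; 3; 5; 1], [:: 0; 4; 3; 2; 8]);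
  ((false, true, false), [:: 2; 5; 6; 3; 4; 1; 0], [:: 1; 3; 2; 4; 0], [:: 0; 2; 5; 7; 4]);
  ((false, true, true), [:: 3; 1; 0; 2; 6; 4; 5], [:: 1; 4; 6; 2; 0], [:: 8; 2; 4; 3; 0]);
  ((true, true, false), [:: 0; 2; 6; 4; 5; 3; 1], [:: 8; 6; 2; 3; 0], [:: 0; 2; 4; 5; 1]);
  ((true, false, true), [:: 5; 3; 1; 2; 0; 4; 6], [:: 0; 3; 5; 2; 8], [:: 1; 6; 4; 2; 0]);
  ((true, true, true), [:: 0; 1; 5; 2; 6; 3; 4], [:: 4; 5; 6; 2; 0], [:: 1; 2; 5; 4; 0]);
  ((false, false, true), [:: 4; 2; 0; 1; 5; 3; 6], [:: 0; 4; 6; 2; 1], [:: 4; 7; 5; 2; 0]);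
  ((true, false, false), [:: 6; 4; 2; 1; 0; 3; 5], [:: 0; 2; 4; 7; 6], [:: 0; 6; 4; 2; 1])].

Definition mirror_matchings : seq matching := [::
  ((false, false, false), [:: 6; 5; 4; 3; 2; 1; 0], [:: 0; 2; 5; 3; 1], [:: 0; 3; 2; 6; 8]);
  ((false, false, false), [:: 6; 5; 4; 3; 2; 0; 1], [:: 0; 2; 5; 3; 1], [:: 0; 3; 2; 6; 7]);
  ((true, false, true), [:: 5; 3; 0; 4; 1; 2; 6], [:: 0; 3; 2; 7; 6], [:: 1; 4; 2; 6; 0]);
  ((false, false, true), [:: 3; 0; 1; 2; 4; 5; 6], [:: 0; 5; 2; 4; 1], [:: 5; 6; 2; 3; 0]);
  ((false, false, true), [:: 4; 0; 1; 3; 2; 5; 6], [:: 0; 4; 2; 6; 1], [:: 4; 5; 2; 3; 0]);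
  ((true, false, false), [:: 6; 4; 0; 3; 2; 1; 5], [:: 0; 2; 5; 4; 8], [:: 0; 4; 2; 6; 1])].

(** All the states found by the search match one of the two layouts. *)
Lemma run_start st : st \in run 9 start ->
  has (matches spiral st) spiral_matchings || has (matches mirror st) mirror_matchings.
Proof. by move: st; apply/allP; vm_compute. Qed.

(** Whether a tile of a layout contains the cell between the lines i and i + 1
    and the lines j and j + 1. *)
Definition in_cell (i j : nat) (t : tile) : bool :=
  (t.1.1 <= i < t.1.2) && (t.2.1 <= j < t.2.2).

Lemma spiral_cells i j : i < 4 -> j < 4 ->
  exists2 k : 'I_7, in_cell i j (nth tile0 spiral k) &
    forall l : 'I_7, in_cell i j (nth tile0 spiral l) -> l = k.
Proof.
move=> i4 j4; pose unique_cell i j := has (fun k => in_cell i j (nth tile0 spiral k) &&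
  all (fun l => in_cell i j (nth tile0 spiral l) ==> (l == k)) (iota 0 7)) (iota 0 7).
have /allP/(_ i) : all (fun i => all (unique_cell i) (iota 0 4)) (iota 0 4) by vm_compute.
rewrite mem_iota => /(_ i4)/allP/(_ j); rewrite mem_iota => /(_ j4)/hasP[k].
rewrite mem_iota => k7 /andP[kc /allP uk]; exists (Ordinal k7) => // l lc.
by apply/val_inj/eqP; apply: (implyP (uk l _)) lc; rewrite mem_iota /=.
Qed.

(** Whether the bounding box of the tiles of [spiral] selected by m overlaps a tile
    which is not selected. *)
Definition hull_meets (m : bitseq) : bool :=
  let sel := mask m spiral in
  has (fun t => [&& has (fun u => u.1.1 < t.1.2) sel, has (fun u => t.1.1 < u.1.2) sel,
                    has (fun u => u.2.1 < t.2.2) sel & has (fun u => t.2.1 < u.2.2) sel])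
    (mask (map negb m) spiral).

Lemma mem_masks m : m \in masks (size m).
Proof.
elim: m => [|b m IHm] //.
by apply/allpairsP; exists (b, m); split=> //; case: b.
Qed.

(** The combinatorial reason why the spiral layout is proper. *)
Lemma spiral_hull m : size m = 7 -> 1 < count id m < 7 -> hull_meets m.
Proof.
move=> m7; have mm : m \in masks 7 by rewrite -m7 mem_masks.
have /allP/(_ m mm)/implyP : all (fun m => (1 < count id m < 7) ==> hull_meets m) (masks 7).
  by vm_compute.
exact.
Qed.

Lemma has_mask_spiral (A : pred 'I_7) (p : pred tile) :
  has p (mask [seq A k | k <- enum 'I_7] spiral) ->
  exists2 k : 'I_7, A k & p (nth tile0 spiral k).
Proof.
have -> : spiral = [seq nth tile0 spiral (k : 'I_7) | k <- enum 'I_7].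
  by rewrite (map_comp (nth tile0 spiral) val) val_enum_ord.
rewrite -map_mask -filter_mask has_map => /hasP[k]; rewrite mem_filter => /andP[Ak _] /= pk.
by exists k => //; move: pk; rewrite (nth_map k) ?size_enum_ord ?nth_ord_enum.
Qed.

Local Open Scope classical_set_scope.
Local Open Scope ring_scope.

(** * Half-open rectangles *)

Section HalfOpen.
Variable R : realType.
Implicit Types (r : rectangle R) (x y : R).

(** Membership in the half-open rectangle. *)
Definition inside r x y : bool := (xmin r <= x < xmax r) && (ymin r <= y < ymax r).

Lemma regionP r x y :
  region r (x, y) <-> [/\ xmin r <= x, x <= xmax r, ymin r <= y & y <= ymax r].
Proof.
rewrite /region /= !in_itv /=; split.
  by move=> [/andP[? ?] /andP[? ?]].
by move=> [-> -> -> ->].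
Qed.

Lemma insideP r x y :
  reflect [/\ xmin r <= x, x < xmax r, ymin r <= y & y < ymax r] (inside r x y).
Proof.
apply: (iffP idP) => [/andP[/andP[? ?] /andP[? ?]] //|[? ? ? ?]].
by rewrite /inside; apply/andP; split; apply/andP.
Qed.

Lemma inside_corner r : inside r (xmin r) (ymin r).
Proof. by apply/insideP; rewrite !lexx xmin_lt_xmax ymin_lt_ymax. Qed.

(** A displacement smaller than all the positive differences listed in s: moving a
    coordinate by it crosses no other line. *)
Lemma small_enough (s : seq R) :
  exists2 e : R, 0 < e & forall d, d \in s -> 0 < d -> e < d.
Proof.
elim: s => [|d s [e e0 he]]; first by exists 1.
have [d0|d0] := ltP 0 d.
  exists (Num.min e d / 2) => [|d']; first by rewrite divr_gt0 // lt_min e0 d0.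
  have m1 : Num.min e d <= e by rewrite ge_min lexx.
  have m2 : Num.min e d <= d by rewrite ge_min lexx orbT.
  rewrite inE => /predU1P[-> _|ds /(he _ ds)]; lra.
exists e => // d'; rewrite inE => /predU1P[->|]; last exact: he.
by rewrite ltNge d0.
Qed.

Lemma interior_inside r x y : (region r)° (x, y) -> inside r x y.
Proof.
move=> /[dup] /interior_subset /regionP[x1 x2 y1 y2].
rewrite /interior /= => /nbhs_ballP[e /= e0 he].
have /he /regionP[] : ball (x, y) e (x + e / 2, y + e / 2).
  split => /=; rewrite -ball_normE /= opprD addrA subrr sub0r normrN gtr0_norm; lra.
by move=> ? ? ? ?; apply/insideP; split => //; lra.
Qed.

Lemma open_interior r x y :
  xmin r < x -> x < xmax r -> ymin r < y -> y < ymax r -> (region r)° (x, y).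
Proof.
move=> x1 x2 y1 y2; apply/nbhs_ballP.
have [e e0 he] := small_enough [:: x - xmin r; xmax r - x; y - ymin r; ymax r - y].
exists e => //= -[u v] [/=]; rewrite -!ball_normE /= !ltr_norml => /andP[u1 u2] /andP[v1 v2].
have := he (x - xmin r); have := he (xmax r - x).
have := he (y - ymin r); have := he (ymax r - y).
rewrite !inE !eqxx !orbT /= => /(_ isT) h1 /(_ isT) h2 /(_ isT) h3 /(_ isT) h4.
by apply/regionP; split; lra.
Qed.

Section Cover.
Variables (k : nat) (P : 'I_k -> rectangle R) (A : pred 'I_k).

(** Closed covers restrict to half-open ones: a point slightly above and to the
    right of a point of the half-open r lies in a closed tile, whose half-open
    version contains the original point. *)
Lemma cover_inside r x y :
  (forall p, region r p -> exists2 i, A i & region (P i) p) ->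
  inside r x y -> exists2 i, A i & inside (P i) x y.
Proof.
move=> cov /insideP[x1 x2 y1 y2].
pose s := [:: xmax r - x; ymax r - y] ++
  [seq xmin (P i) - x | i <- enum 'I_k] ++ [seq ymin (P i) - y | i <- enum 'I_k].
have [e e0 he] := small_enough s.
have hx : e < xmax r - x by apply: he; rewrite ?inE ?eqxx //; lra.
have hy : e < ymax r - y by apply: he; rewrite ?inE ?eqxx ?orbT //; lra.
have [|i Ai /regionP[i1 i2 i3 i4]] := cov (x + e, y + e).
  by apply/regionP; split; lra.
exists i => //; apply/insideP; split; try lra; rewrite leNgt; apply/negP => lt.
  have : e < xmin (P i) - x.
    apply: he; last lra.
    by rewrite /s !mem_cat; apply/or3P/Or32/mapP; exists i; rewrite ?mem_enum.
  lra.
have : e < ymin (P i) - y.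
  apply: he; last lra.
  by rewrite /s !mem_cat; apply/or3P/Or33/mapP; exists i; rewrite ?mem_enum.
lra.
Qed.

(** Half-open covers extend to closed ones: a point on the top or right side of r
    is moved slightly inside. *)
Lemma cover_region r :
  (forall x y, inside r x y -> exists2 i, A i & inside (P i) x y) ->
  forall p, region r p -> exists2 i, A i & region (P i) p.
Proof.
move=> cov [x y] /regionP[x1 x2 y1 y2].
pose s := [:: xmax r - xmin r; ymax r - ymin r] ++
  [seq x - xmax (P i) | i <- enum 'I_k] ++ [seq y - ymax (P i) | i <- enum 'I_k].
have [e e0 he] := small_enough s.
have wr := xmin_lt_xmax r; have hr := ymin_lt_ymax r.
have hx : e < xmax r - xmin r by apply: he; rewrite ?inE ?eqxx //; lra.
have hy : e < ymax r - ymin r by apply: he; rewrite ?inE ?eqxx ?orbT //; lra.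
have [x' [? ? ? ?]] : exists x', [/\ x' <= x, x <= x' + e, xmin r <= x' & x' < xmax r].
  by case: (ltP x (xmax r)) => ?; [exists x | exists (x - e)]; split; lra.
have [y' [? ? ? ?]] : exists y', [/\ y' <= y, y <= y' + e, ymin r <= y' & y' < ymax r].
  by case: (ltP y (ymax r)) => ?; [exists y | exists (y - e)]; split; lra.
have [|i Ai /insideP[i1 i2 i3 i4]] := cov x' y'; first exact/insideP.
exists i => //; apply/regionP; split; try lra; rewrite leNgt; apply/negP => lt.
  have : e < x - xmax (P i).
    apply: he; last lra.
    by rewrite /s !mem_cat; apply/or3P/Or32/mapP; exists i; rewrite ?mem_enum.
  lra.
have : e < y - ymax (P i).
  apply: he; last lra.
  by rewrite /s !mem_cat; apply/or3P/Or33/mapP; exists i; rewrite ?mem_enum.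
lra.
Qed.

End Cover.

Lemma inside_sub r1 r2 :
  (forall x y, inside r1 x y -> inside r2 x y) ->
  [/\ xmin r2 <= xmin r1, xmax r1 <= xmax r2, ymin r2 <= ymin r1 & ymax r1 <= ymax r2].
Proof.
move=> sub; have /insideP[? ? ? ?] := sub _ _ (inside_corner r1).
have w1 := xmin_lt_xmax r1; have h1 := ymin_lt_ymax r1.
split => //; rewrite leNgt; apply/negP => lt.
  have /sub /insideP[] : inside r1 (xmax r2) (ymin r1) by apply/insideP; split; lra.
  by rewrite ltxx.
have /sub /insideP[] : inside r1 (xmin r1) (ymax r2) by apply/insideP; split; lra.
by rewrite ltxx.
Qed.

Lemma region_sub r1 r2 : region r1 `<=` region r2 ->
  [/\ xmin r2 <= xmin r1, xmax r1 <= xmax r2, ymin r2 <= ymin r1 & ymax r1 <= ymax r2].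
Proof.
have w1 := xmin_lt_xmax r1; have h1 := ymin_lt_ymax r1.
move=> sub.
have /sub /regionP[? ? ? ?] : region r1 (xmin r1, ymin r1) by apply/regionP; split; lra.
have /sub /regionP[? ? ? ?] : region r1 (xmax r1, ymax r1) by apply/regionP; split; lra.
by [].
Qed.

Section Partition.
Variables (k : nat) (S : rectangle R) (P : 'I_k -> rectangle R).
Hypothesis partP : is_partition S P.

Lemma partition_sub i :
  [/\ xmin S <= xmin (P i), xmax (P i) <= xmax S, ymin S <= ymin (P i) & ymax (P i) <= ymax S].
Proof.
case: partP => _ cov _; apply: region_sub => p Pp.
by rewrite -cov; exists i.
Qed.

Lemma partition_cover x y : inside S x y -> exists i, inside (P i) x y.
Proof.
case: partP => _ cov _ Sxy.
have [|i _ ?] := @cover_inside k P xpredT S x y _ Sxy; last by exists i.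
by move=> p; rewrite -cov => -[i _ ip]; exists i.
Qed.

Lemma partition_inside i x y : inside (P i) x y -> inside S x y.
Proof.
have [? ? ? ?] := partition_sub i => /insideP[? ? ? ?].
by apply/insideP; split; lra.
Qed.

Lemma partition_disjoint i j x y : inside (P i) x y -> inside (P j) x y -> i = j.
Proof.
case: partP => _ _ triv /insideP[x1 x2 y1 y2] /insideP[x3 x4 y3 y4].
have [e e0 he] := small_enough [:: xmax (P i) - x; xmax (P j) - x; ymax (P i) - y; ymax (P j) - y].
have := he (xmax (P i) - x); have := he (xmax (P j) - x).
have := he (ymax (P i) - y); have := he (ymax (P j) - y).
rewrite !inE !eqxx !orbT /= => /(_ isT) h1 /(_ isT) h2 /(_ isT) h3 /(_ isT) h4.
apply: triv => //; exists (x + e, y + e); split; apply: open_interior; lra.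
Qed.

End Partition.

Lemma partition_of_inside k S (P : 'I_k -> rectangle R) : (2 <= k)%N ->
  (forall x y, inside S x y -> exists i, inside (P i) x y) ->
  (forall i x y, inside (P i) x y -> inside S x y) ->
  (forall i j x y, inside (P i) x y -> inside (P j) x y -> i = j) ->
  is_partition S P.
Proof.
move=> k2 cov sub dis; split => //.
  apply/seteqP; split => [[x y] [i _ /regionP[? ? ? ?]]|p Sp].
    by have [? ? ? ?] := inside_sub (sub i); apply/regionP; split; lra.
  have [|i _ ?] := @cover_region k P xpredT S _ p Sp; last by exists i.
  by move=> x y /cov[i]; exists i.
by move=> i j _ _ [[x y] [/interior_inside ix /interior_inside jx]]; apply: dis ix jx.
Qed.

(** The indicator of the half-line from a to infinity, as a function of x. *)
Definition jump (a x : R) : int := (a <= x)%R%:Z.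

Lemma jump_inside r x y : (inside r x y)%:Z =
  (jump (xmin r) x - jump (xmax r) x) * (jump (ymin r) y - jump (ymax r) y).
Proof.
have w := xmin_lt_xmax r; have h := ymin_lt_ymax r.
rewrite /inside /jump.
by case: (leP (xmin r) x) => ?; case: (leP (xmax r) x) => ?; case: (leP (ymin r) y) => ?;
  case: (leP (ymax r) y) => ? //=; exfalso; lra.
Qed.

(** If the indicators of the tiles of s sum up to the product of two differences of
    jumps, then these tiles fill a rectangle. No order is assumed between a and b or
    between c and d: as the sum is nonnegative and takes a positive value, either a
    < b and c < d, or a > b and c > d. *)
Lemma box_of_jumps k (P : 'I_k -> rectangle R) (s : seq 'I_k) (a b c d : R) :
  s != [::] ->
  (forall x y, \sum_(i <- s) (inside (P i) x y)%:Z =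
     (jump a x - jump b x) * (jump c y - jump d y)) ->
  exists r, forall x y, inside r x y = has (fun i => inside (P i) x y) s.
Proof.
move=> s0 sumE.
have pos x y : has (fun i => inside (P i) x y) s = (0 < \sum_(i <- s) (inside (P i) x y)%:Z).
  elim: {s0 sumE} s => [|i s IHs]; first by rewrite big_nil.
  rewrite big_cons /= IHs; have : 0 <= \sum_(j <- s) (inside (P j) x y)%:Z by apply: sumr_ge0.
  by case: inside => /=; lia.
have [i si] : exists i, i \in s by case: s s0 {sumE pos} => // i s _; exists i; rewrite inE eqxx.
have := pos (xmin (P i)) (ymin (P i)).
rewrite (_ : has _ _ = true); last by apply/hasP; exists i => //; exact: inside_corner.
rewrite sumE => /esym; rewrite {1 2 3 4}/jump.
move: (xmin (P i)) (ymin (P i)) => x y.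
wlog xab : a b c d sumE / a <= x.
  move=> wl; case: (leP a x) => ax; first by have := wl a b c d sumE ax; rewrite ax.
  have sumE' : forall x y, \sum_(i <- s) (inside (P i) x y)%:Z =
     (jump b x - jump a x) * (jump d y - jump c y) by move=> u v; rewrite sumE; ring.
  case: (leP b x) => bx; last by rewrite subrr mul0r.
  have := wl b a d c sumE' bx; rewrite bx (leNgt a) ax /=.
  by case: (c <= y); case: (d <= y) => //=; apply.
rewrite xab; case: (leP b x) => bx; first by rewrite subrr mul0r.
case: (leP c y) => cy; case: (leP d y) => dy //= _.
have ab := le_lt_trans xab bx; have cd := le_lt_trans cy dy.
exists (Rectangle ab cd) => u v; rewrite pos sumE -(jump_inside (Rectangle ab cd)).
by case: inside.
Qed.

(** The tiles of a proper partition indexed by s cannot fill a rectangle r. *)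
Lemma not_proper k S (P : 'I_k -> rectangle R) (s : seq 'I_k) r :
  is_partition S P -> uniq s -> (1 < size s < k)%N ->
  (forall x y, inside r x y = has (fun i => inside (P i) x y) s) ->
  ~ proper_partition S P.
Proof.
move=> partP us sz rE; apply; exists [set i in s]%SET, r; split.
- by rewrite cardsE (card_uniqP us).
- have [|? ? ? ?] := @inside_sub r S.
    by move=> x y; rewrite rE => /hasP[i _]; apply: partition_inside.
  by move=> [x y] /regionP[? ? ? ?]; apply/regionP; split; lra.
apply/seteqP; split => [[x y] [i /=]|p rp].
  rewrite inE => si /regionP[? ? ? ?].
  have [|? ? ? ?] := @inside_sub (P i) r.
    by move=> u v iuv; rewrite rE; apply/hasP; exists i.
  by apply/regionP; split; lra.
have [|i si ip] := @cover_region k P (mem s) r _ p rp.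
  by move=> x y; rewrite rE => /hasP[i]; exists i.
by exists i => //=; rewrite inE.
Qed.

End HalfOpen.

(** * Soundness of the search *)

Lemma mem_full n (idx : seq 'I_n) : uniq idx -> size idx = n -> forall i, i \in idx.
Proof.
move=> us sz i; apply: contraT => ni.
have : (size (i :: idx) <= size (enum 'I_n))%N.
  by apply: uniq_leq_size => [|j _]; rewrite ?mem_enum //= ni.
by rewrite size_enum_ord /= sz ltnn.
Qed.

Section Soundness.
Variables (R : realType) (S : rectangle R) (P : 'I_7 -> rectangle R).
Hypothesis partP : is_partition S P.
Hypothesis properP : proper_partition S P.
Implicit Types (vx vy : nat -> R) (idx : seq 'I_7).

Definition compares (s : sign) (u v : R) : bool :=
  match s with Lower => u < v | Level => u == v | Higher => v < u end.

(** The rectangle r is the value of the symbolic tile t, when vx and vy give the values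
    of the names of abscissas and ordinates. *)
Definition fits vx vy (t : tile) (r : rectangle R) : bool :=
  [&& xmin r == vx t.1.1, xmax r == vx t.1.2, ymin r == vy t.2.1 & ymax r == vy t.2.2].

Definition fit_all vx vy (ts : seq tile) idx : bool :=
  all2 (fun t i => fits vx vy t (P i)) ts idx.

(** The union of the tiles of P indexed by idx. *)
Definition covered idx (x y : R) : bool := has (fun i => inside (P i) x y) idx.

(** The values of sky form a skyline over the interval from a to the right side of
    the square, h0 being the ordinate of what is on its left: the signs are right,
    and cov is the set of the points of the square below the skyline. *)
Fixpoint skyline_ok vx vy (cov : R -> R -> bool) (a h0 : R) (sky : seq plateau) : Prop :=
  if sky is (b, h, s) :: k then
    [/\ a < vx b, compares s (vy h) h0, ymin S <= vy h <= ymax S,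
        forall x y, a <= x < vx b -> ymin S <= y < ymax S -> cov x y = (y < vy h) &
        skyline_ok vx vy cov (vx b) (vy h) k]
  else a = xmax S.

(** The state st describes the tiles of P indexed by idx. The left side of the square
    gets the height [ymax S + 1], so that every plateau is lower than it. *)
Record realizes vx vy idx (st : state) : Prop := Realizes {
  realizes_x0 : vx 0%N = xmin S;
  realizes_x1 : vx 1%N = xmax S;
  realizes_y0 : vy 0%N = ymin S;
  realizes_uniq : uniq idx;
  realizes_tiles : fit_all vx vy st.1 idx;
  realizes_sky : skyline_ok vx vy (covered idx) (xmin S) (ymax S + 1) st.2
}.

Lemma compares_total u v : exists2 s, s \in signs & compares s u v.
Proof.
by case: (ltgtP u v) => uv; [exists Lower | exists Higher | exists Level]; rewrite //= uv.
Qed.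

Lemma sum_cancel_corners (f : nat * nat -> int) p n :
  let r := cancel_corners p n in
  \sum_(c <- r.1) f c - \sum_(c <- r.2) f c = \sum_(c <- p) f c - \sum_(c <- n) f c.
Proof.
elim: p n => [|c p IHp] n //=; case: ifP => cn /=.
  by rewrite IHp (perm_big _ (perm_to_rem cn)) /= !big_cons; ring.
by rewrite !big_cons -!addrA IHp.
Qed.

Lemma all2_mask (T U : Type) (r : T -> U -> bool) m s t :
  all2 r s t -> all2 r (mask m s) (mask m t).
Proof.
by elim: m s t => [|[] m IHm] [|x s] [|y t] //= => [/andP[-> /IHm]|/andP[_ /IHm]].
Qed.

Lemma is_box_sound vx vy ts (s : seq 'I_7) : s != [::] ->
  fit_all vx vy ts s -> is_box ts ->
  exists r, forall x y, inside r x y = has (fun i => inside (P i) x y) s.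
Proof.
move=> s0 fit.
pose f x y (c : nat * nat) := jump (vx c.1) x * jump (vy c.2) y.
have sumE x y : \sum_(i <- s) (inside (P i) x y)%:Z =
    \sum_(c <- pos_corners ts) f x y c - \sum_(c <- neg_corners ts) f x y c.
  rewrite /pos_corners /neg_corners !big_flatten /= !big_map.
  elim: s ts fit {s0} => [|i s IHs] [|t ts] //=; first by rewrite !big_nil.
  move=> /andP[/and4P[/eqP e1 /eqP e2 /eqP e3 /eqP e4] /IHs IH].
  rewrite !big_cons !big_nil /= IH jump_inside /f e1 e2 e3 e4 /=; ring.
have := fun x y => sum_cancel_corners (f x y) (pos_corners ts) (neg_corners ts).
rewrite /is_box; move: sumE; case: cancel_corners => p n /=.
case: p => [|p1 [|p2 [|? ?]]] //; case: n => [|n1 [|n2 [|? ?]]] // sumE cancelE np.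
apply: (@box_of_jumps _ _ _ s (vx p1.1) (vx p2.1) (vy p1.2) (vy p2.2) s0) => x y.
rewrite sumE -cancelE (perm_big _ np) /= !big_cons !big_nil /f /=; ring.
Qed.

Lemma improper_sound vx vy ms ts idx : uniq idx ->
  fit_all vx vy ts idx -> improper ms ts -> False.
Proof.
move=> uidx fit /hasP[m _ /=]; case: ifP => // sz box.
have fitm := all2_mask m fit.
have szE : size (mask m ts) = size (mask m idx).
  by move: fitm; rewrite all2E => /andP[/eqP].
have [|r rE] := is_box_sound _ fitm box.
  by rewrite -size_eq0 -szE; case: (size _) sz.
have sz' : (1 < size (mask m idx) < 7)%N by rewrite -szE.
exact: not_proper partP (mask_uniq uidx m) sz' rE properP.
Qed.

Lemma eq_skyline_ok n vx vy cov vx' vy' cov' a h0 sky :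
  (forall u, (u < n)%N -> vx' u = vx u) -> (forall u, (u < n)%N -> vy' u = vy u) ->
  (forall x y, a <= x -> cov' x y = cov x y) -> all (declared n) sky ->
  skyline_ok vx vy cov a h0 sky -> skyline_ok vx' vy' cov' a h0 sky.
Proof.
move=> ex ey; elim: sky a h0 => [|[[b h] s] k IHk] a h0 //= ecov.
move=> /andP[/and3P[bn hn _] kn] [ab cmp hS cov1 sk].
rewrite ex // ey //; split => // [x y xab yS|].
  by rewrite ecov; [exact: cov1 | case/andP: xab].
by apply: IHk => // x y xb; apply: ecov; lra.
Qed.

Lemma merge_sound vx vy cov a h0 sky sky' u v :
  merge sky = Some (sky', (u, v)) -> skyline_ok vx vy cov a h0 sky ->
  vy u = vy v /\ skyline_ok vx vy cov a h0 sky'.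
Proof.
elim: sky a h0 sky' => [|[[b h] s] k IHk] a h0 sky' //.
case: k IHk => [|[[b' h'] s'] k'] IHk //.
case: s' IHk => IHk.
- rewrite -[merge _]/(omap (fun r => ((b, h, s) :: r.1, r.2)) (merge ((b', h', Lower) :: k'))).
  case E: (merge (_ :: k')) => [[sky1 [u1 v1]]|] //= [<- ? ?] [ab cmp hS cov1 sk]; subst.
  by have [? ?] := IHk (vx b) (vy h) sky1 E sk.
- move=> [<- <- <-] [ab cmp hS cov1 [bb /eqP hh hS' cov2 sk]]; split=> //=.
  split => //; [exact: lt_trans bb| |by rewrite -hh].
  move=> x y /andP[ax xb] yS; case: (ltP x (vx b)) => xb1.
    by apply: cov1; rewrite ?ax.
  by rewrite -hh; apply: cov2; rewrite ?xb1.
- rewrite -[merge _]/(omap (fun r => ((b, h, s) :: r.1, r.2)) (merge ((b', h', Higher) :: k'))).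
  case E: (merge (_ :: k')) => [[sky1 [u1 v1]]|] //= [<- ? ?] [ab cmp hS cov1 sk]; subst.
  by have [? ?] := IHk (vx b) (vy h) sky1 E sk.
Qed.

Lemma rename_val vy u v h : vy u = vy v -> vy (rename u v h) = vy h.
Proof. by rewrite /rename; case: eqP => // ->. Qed.

Lemma normalize_sound vx vy idx st : realizes vx vy idx st -> realizes vx vy idx (normalize st).
Proof.
case: st => ts sky [x0 x1 y0 us fit sk]; rewrite /normalize /=.
case E: (merge sky) => [[sky' [u v]]|]; last by split.
have [uv sk'] := merge_sound E sk; split => //=.
  move: fit; rewrite /fit_all !all2E size_map => /andP[-> /=].
  elim: ts idx {sk sk' us} => [|t ts IHts] [|i idx] //= /andP[fit /IHts ->].
  by rewrite andbT; move: fit; rewrite /fits /= !rename_val.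
elim: sky' (xmin S) (ymax S + 1) {E} sk' => [|[[b h] s] k IHk] a h0 //=.
by rewrite rename_val // => -[? ? ? ? /IHk].
Qed.

(** The valuation v, with the value c for the name n. *)
Definition upd (v : nat -> R) (n : nat) (c : R) (u : nat) : R := if u == n then c else v u.

Lemma upd_lt v n c u : (u < n)%N -> upd v n c u = v u.
Proof. by rewrite /upd => un; rewrite ltn_eqF. Qed.

Lemma upd_eq v n c : upd v n c n = c.
Proof. by rewrite /upd eqxx. Qed.

(** Arbitrarily close to the abscissa a on its left, there are vertical lines whose part
    below h0 is covered. *)
Definition left_wall idx (a h0 : R) : Prop :=
  forall x1, xmin S <= x1 < a -> exists2 x, x1 <= x < a &
    forall y, ymin S <= y < ymax S -> y < h0 -> covered idx x y.

(** The main step of the search. The tile i of P through the left end of the first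
    valley of the skyline is not yet placed, it has its lower left corner there and
    does not overhang the valley; so it is among the guesses of [place]. *)
Lemma place_sound n (ss : seq sign) vx vy idx a h0 sky :
  (a < n)%N -> all (declared n) sky -> descends sky ->
  xmin S <= vx a ->
  (forall t, t <= ymax S -> exists2 s, s \in ss & compares s t h0) ->
  (h0 <= ymax S \/ forall b h s, sky = [:: (b, h, s)] -> vy h < ymax S) ->
  skyline_ok vx vy (covered idx) (vx a) h0 sky ->
  left_wall idx (vx a) h0 ->
  exists i, [/\ i \notin idx, vx a <= xmin (P i) &
    exists2 tk, tk \in place n ss a sky &
      let vx' := upd vx n (xmax (P i)) in let vy' := upd vy n (ymax (P i)) in
      fits vx' vy' tk.1 (P i) /\
      skyline_ok vx' vy' (covered (i :: idx)) (vx a) h0 tk.2].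
Proof.
elim: sky ss a h0 => [|[[b h] s] k IHk] ss a h0 //.
move=> an /andP[/and3P[/= bn hn _] kn].
case: s => // _ Sa ssP top [ab hh0 /andP[Sh hS] cov1 sk] lw.
rewrite [place _ _ _ _]/=; case: ifPn => vk; last first.
  have {vk}[kL kn0] : descends k /\ k != [::].
    by case: k kn vk {IHk sk top} => [|[[? ?] []] ?] //= /andP[/and3P[]].
  have [|||||i [ni bi [tk tkp [fit ok]]]] := IHk signs b (vy h) _ kn kL _ _ _ sk.
  - by [].
  - exact: le_trans Sa (ltW ab).
  - by move=> t _; have [s ? ?] := compares_total t (vy h); exists s.
  - by left.
  - move=> x1 /andP[Sx xb]; exists (Num.max x1 (vx a)).
      by rewrite le_max lexx /= gt_max xb ab.
    move=> y yS yh; rewrite cov1 // le_max lexx orbT /= gt_max xb ab //.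
  exists i; split => //; first exact: le_trans (ltW ab) bi.
  exists (tk.1, (b, h, Lower) :: tk.2); first by apply/mapP; exists tk.
  split => //=; rewrite !upd_lt //; split => //; first by apply/andP.
  move=> x y /andP[ax xb] yS; rewrite -(cov1 x y) ?ax //= (_ : inside _ _ _ = false) //.
  by apply/insideP => -[]; lra.
(* The valley is below the top of the square: one of its neighbours is higher, or it is
   the whole skyline and this is assumed. *)
have hlt : vy h < ymax S.
  case: top => [h0S|top]; first exact: lt_le_trans h0S.
  case: k vk sk top {IHk kn} => [|[[b2 h2] s2] k2] /=.
    by move=> _ _ /(_ b h Lower erefl).
  by case: s2 => // _ [_ lt2 /andP[_ h2S] _ _] _; apply: lt_le_trans h2S.
have bS : vx b <= xmax S.
  elim: k (vx b) (vy h) sk {IHk kn vk top cov1 ab hh0 Sh hS hlt} => [|[[b2 h2] s2] k2 IH] c hc /=.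
    by move=> ->.
  by move=> [cb _ _ _ /IH]; apply: le_trans; apply: ltW.
have [i ih] : exists i, inside (P i) (vx a) (vy h).
  by apply: (partition_cover partP); apply/insideP; split; lra.
have ni : i \notin idx.
  apply/negP => ii; have := cov1 (vx a) (vy h); rewrite lexx ab Sh hlt ltxx => /(_ isT isT).
  by move/hasP; apply; exists i.
have disj x y : inside (P i) x y -> covered idx x y -> False.
  by move=> ixy /hasP[j jdx /(partition_disjoint partP ixy) ij]; rewrite ij jdx in ni.
have [Si1 Si2 Si3 Si4] := partition_sub partP i.
have wi := xmin_lt_xmax (P i); have hi := ymin_lt_ymax (P i).
have /insideP[i1 i2 i3 i4] := ih.
have xi : xmin (P i) = vx a.
  apply/eqP; rewrite eq_le i1 leNgt; apply/negP => lt.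
  have [|x /andP[x1 x2] cov] := lw (xmin (P i)); first by rewrite Si1 lt.
  apply: (disj x (vy h)); first by apply/insideP; split; lra.
  by apply: cov; rewrite ?Sh.
have yi : ymin (P i) = vy h.
  apply/eqP; rewrite eq_le i3 leNgt; apply/negP => lt.
  apply: (disj (vx a) (ymin (P i))); first by apply/insideP; split; lra.
  by rewrite cov1 ?lexx ?ab // Si3; lra.
have xib : xmax (P i) <= vx b.
  case: k vk sk {IHk kn top} => [|[[b2 h2] s2] k2] /=; first by move=> _ ->.
  case: s2 => // _ [b12 lt2 _ cov2 _]; rewrite leNgt; apply/negP => lt.
  apply: (disj (vx b) (vy h)); first by apply/insideP; split; lra.
  by rewrite cov2 ?lexx ?b12 ?Sh ?hlt.
have [s sss cmps] := ssP _ Si4.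
have covi x y : covered (i :: idx) x y = inside (P i) x y || covered idx x y by [].
have cov_right x y : xmax (P i) <= x -> covered (i :: idx) x y = covered idx x y.
  by move=> ix; rewrite covi (_ : inside _ _ _ = false) //; apply/insideP => -[]; lra.
have cov_in x y : vx a <= x < xmax (P i) -> ymin S <= y < ymax S ->
    covered (i :: idx) x y = (y < ymax (P i)).
  move=> /andP[ax xx] yS; rewrite covi cov1 //; last by rewrite ax; lra.
  rewrite /inside xi ax xx yi /=; case: (ltP y (vy h)) => yh /=; last by rewrite orbF.
  by apply/esym; lra.
exists i; split => //; first by rewrite xi.
case: (ltP (xmax (P i)) (vx b)) => [lt|ge].
  exists ((a, n, (h, n)), (n, n, s) :: (b, h, Lower) :: k).
    by rewrite mem_cat; apply/orP; left; apply/mapP; exists s.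
  rewrite /fits /= !upd_eq !upd_lt // xi yi !eqxx; split => //.
  split => //; first by apply/andP; split; lra.
  split => //; first by rewrite Sh.
    by move=> x y /andP[x1 x2] yS; rewrite -covi cov_right // cov1 //; lra.
  by apply: (eq_skyline_ok _ _ _ kn sk) => [u|u|x y bx];
    [exact: upd_lt | exact: upd_lt | apply: cov_right; lra].
have xibE : xmax (P i) = vx b by lra.
have [k' kk' ok'] : exists2 k', k' \in resign k &
   skyline_ok (upd vx n (xmax (P i))) (upd vy n (ymax (P i))) (covered (i :: idx))
     (vx b) (ymax (P i)) k'.
  have := @eq_skyline_ok n _ _ _ (upd vx n (xmax (P i))) (upd vy n (ymax (P i)))
     (covered (i :: idx)) _ _ _ _ _ _ kn sk.
  case: k {IHk kn vk sk xib top} => [|[[b2 h2] s2] k2] eqk.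
    exists [::] => //; apply: eqk => [u|u|x y bx];
      [exact: upd_lt | exact: upd_lt | apply: cov_right; lra].
  have [s' s's cmp'] := compares_total (upd vy n (ymax (P i)) h2) (ymax (P i)).
  exists ((b2, h2, s') :: k2); first by apply/mapP; exists s'.
  have [|||? ? ? ? ?] := eqk; last by split.
  - by move=> u; apply: upd_lt.
  - by move=> u; apply: upd_lt.
  - by move=> x y bx; apply: cov_right; lra.
exists ((a, b, (h, n)), (b, n, s) :: k').
  by rewrite mem_cat; apply/orP; right; apply/allpairsP; exists (s, k').
rewrite /fits /= !upd_eq !upd_lt // xi yi xibE !eqxx -xibE; split => //.
by rewrite -xibE in ok'; split => //; apply/andP; split; lra.
Qed.


(** If fewer than seven tiles are placed or the skyline is not flat, then the
    description of the placed tiles extends to one more tile. *)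
Lemma extensions_sound vx vy idx st : well_formed st -> realizes vx vy idx st ->
  ((size st.1 < 7) || (1 < size st.2))%N ->
  exists2 st', st' \in extensions st &
    exists vx' vy' i, i \notin idx /\ realizes vx' vy' (i :: idx) st'.
Proof.
case: st => ts sky /= /and3P[wts wsky wL] [x0 x1 y0 us fit sk] sz.
set n := (size ts).+2 in wts wsky.
have szi : size ts = size idx by move: fit; rewrite /fit_all all2E => /andP[/eqP].
have [|||||| i [ni _ [tk tkp [fit' sk']]]] :=
    @place_sound n [:: Lower] vx vy idx 0%N (ymax S + 1) sky _ wsky wL.
- by [].
- by rewrite x0.
- by move=> t tS; exists Lower; rewrite ?inE //=; lra.
- right=> b h s skyE; move: sz sk; rewrite skyE orbF szi => sz [_ _ /andP[Sh hS] cov bS].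
  have [j nj] : exists j, j \notin idx.
    apply/existsP; apply: contraTT sz => /existsPn all_in; rewrite -leqNgt.
    rewrite -[X in (X <= _)%N](size_enum_ord 7); apply: uniq_leq_size (enum_uniq _) _ => j _.
    by have := all_in j; rewrite negbK.
  have := cov (xmin (P j)) (ymin (P j)).
  have [Sj1 Sj2 Sj3 Sj4] := partition_sub partP j.
  have wj := xmin_lt_xmax (P j); have hj := ymin_lt_ymax (P j).
  rewrite (_ : covered _ _ _ = false); last first.
    apply/hasP => -[i iidx /(partition_disjoint partP (inside_corner (P j))) ij].
    by rewrite ij iidx in nj.
  case: (ltP (ymin (P j)) (vy h)) => [_ | ? _]; last exact: le_lt_trans (lt_le_trans hj Sj4).
  rewrite bS Sj1 Sj3 (lt_le_trans wj Sj2) (lt_le_trans hj Sj4).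
  by move=> /(_ isT isT).
- by rewrite x0.
- by rewrite x0 => x; lra.
have fits_upd c d : fit_all (upd vx n c) (upd vy n d) ts idx.
  clearbody n; elim: ts idx fit wts {szi sz sk us ni sk' fit' tkp wsky wL} => [|t ts IH] [|j idx] //=.
  move=> /andP[ft fts] /andP[/and4P[? ? ? ?] wts]; rewrite IH // andbT.
  by move: ft; rewrite /fits !upd_lt.
exists (normalize (normalize (tk.1 :: ts, tk.2))); first by apply/mapP; exists tk.
exists (upd vx n (xmax (P i))), (upd vy n (ymax (P i))), i; split=> //.
do 2 apply: normalize_sound; split; rewrite ?upd_lt //=; first by rewrite ni.
  by rewrite fit' fits_upd.
by rewrite -x0.
Qed.

(** The search misses no proper partition. *)
Lemma run_sound fuel vx vy idx st : realizes vx vy idx st ->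
  exists2 st', st' \in run fuel st & exists vx' vy' idx', realizes vx' vy' idx' st'.
Proof.
elim: fuel vx vy idx st => [|f IHf] vx vy idx st real.
  by exists st; rewrite ?inE //; exists vx, vy, idx.
rewrite {1}/run -/run; case: ifPn => wf.
  by exists st; rewrite ?inE //; exists vx, vy, idx.
have [x0 x1 y0 us fit sk] := real.
move: wf; rewrite negbK => wf.
case: ifPn => sz.
  case: ifPn => [imp|_]; first by case: (improper_sound us fit imp).
  have [|st1 st1e [vx1 [vy1 [i [_ /IHf[st2 st2r ex2]]]]]] := extensions_sound wf real.
    by rewrite sz.
  by exists st2 => //; apply/flatten_mapP; exists st1.
case: ifPn => sz2.
  have [|st1 st1e [vx1 [vy1 [i [ni [_ _ _ us1 _ _]]]]]] := extensions_sound wf real.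
    by rewrite sz2 orbT.
  have szi : size st.1 = size idx by move: fit; rewrite /fit_all all2E => /andP[/eqP].
  have : (size (i :: idx) <= size (enum 'I_7))%N.
    by apply: uniq_leq_size us1 _ => j _; rewrite mem_enum.
  by rewrite size_enum_ord /= -szi (negPf sz).
case: ifPn => [imp|_]; first by case: (improper_sound us fit imp).
by exists st; rewrite ?inE //; exists vx, vy, idx.
Qed.

Lemma start_realized : realizes
  (fun u => if u == 0%N then xmin S else xmax S)
  (fun u => if u == 0%N then ymin S else ymax S) [::] start.
Proof.
have w := xmin_lt_xmax S; have h := ymin_lt_ymax S.
split => //=; split => //; [lra| lra|].
by move=> x y _ /andP[yS _]; apply/esym/negbTE; rewrite -leNgt.
Qed.

(** Once all the tiles are placed, the flat skyline is the top side of the square. *)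
Lemma finished_top vx vy idx ts h :
  realizes vx vy idx (ts, [:: (1%N, h, Lower)]) -> size ts = 7%N -> vy h = ymax S.
Proof.
move=> [x0 x1 y0 us fit /= [ab hh0 /andP[Sh hS] cov _]] sz.
apply/eqP; rewrite eq_le hS leNgt; apply/negP => lt.
have [i ih] : exists i, inside (P i) (xmin S) (vy h).
  by apply: (partition_cover partP); apply/insideP; rewrite lexx xmin_lt_xmax Sh lt.
have szi : size ts = size idx by move: fit; rewrite /fit_all all2E => /andP[/eqP].
have iidx : i \in idx by rewrite (mem_full us) -?szi.
have := cov (xmin S) (vy h); rewrite lexx ab Sh lt ltxx => /(_ isT isT) /hasP; apply.
by exists i.
Qed.

End Soundness.

(** * Equal-area equations *)

Section Algebra.
Variable R : realType.

Lemma sqrt19_sq : Num.sqrt (19 : R) ^+ 2 = 19.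
Proof. by rewrite sqr_sqrtr. Qed.

(** These bounds separate the coordinates and the side lengths of the spiral
    partition. *)
Lemma sqrt19_bounds :
  61%:R / 14%:R < Num.sqrt (19 : R) /\ Num.sqrt (19 : R) < 48%:R / 11%:R.
Proof.
have lt_sqrt c d : 0 <= c -> 0 < d -> c ^+ 2 < d ^+ 2 -> (c : R) < d.
  by move=> c0 d0; rewrite ltr_pXn2r // nnegrE // ltW.
split; apply: lt_sqrt; rewrite ?sqrtr_ge0 ?sqrtr_gt0 ?sqrt19_sq //; lra.
Qed.

Lemma equal_area_lt (A u v x y : R) :
  0 < u -> 0 < x -> 0 < A -> u * v = A -> x * y = A -> (v < y) = (x < u).
Proof.
move=> u0 x0 A0 uv xy.
have -> : v = A / u by rewrite -uv mulrC mulKf // gt_eqF.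
have -> : y = A / x by rewrite -xy mulrC mulKf // gt_eqF.
by rewrite ltr_pM2l // ltf_pV2.
Qed.

Lemma equal_area_side (A u v x y : R) : A != 0 -> u * v = A -> x * y = A -> u = x -> v = y.
Proof.
move=> A0 uv xy ux; have u0 : u != 0 by apply: contra_neq A0 => u0; rewrite -uv u0 mul0r.
by apply: (mulfI u0); rewrite uv ux xy.
Qed.

(** In the mirror layout, if tile 0 were narrower than tile 2, it would be higher;
    then tile 3 would be narrower than tile 4, and tile 6 wider than tile 5. But
    tile 6 spans the tiles 0 and 3, and tile 5 the tiles 2 and 4. *)
Lemma mirror_equal_widths (A L : R) (w h : nat -> R) : 0 < A ->
  (forall k, (k < 7)%N -> 0 < w k /\ w k * h k = A) ->
  w 0%N + w 3%N = w 6%N -> w 2%N + w 4%N = w 5%N -> h 0%N + h 6%N = L -> h 2%N + h 5%N = L ->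
  h 1%N + h 3%N = h 0%N -> h 1%N + h 4%N = h 2%N -> w 0%N = w 2%N.
Proof.
move=> A0 wh e1 e2 e3 e4 e5 e6.
have lt i j : (i < 7)%N -> (j < 7)%N -> (h i < h j) = (w j < w i).
  by move=> /wh[wi ai] /wh[wj aj]; apply: equal_area_lt ai aj.
have [lt02|lt20|//] := ltgtP (w 0%N) (w 2%N).
- have h20 : h 2%N < h 0%N by rewrite lt.
  have w34 : w 3%N < w 4%N by rewrite -lt //; clear -h20 e5 e6; lra.
  have w56 : w 5%N < w 6%N by rewrite -lt //; clear -h20 e3 e4; lra.
  by clear -lt02 w34 w56 e1 e2; lra.
- have h02 : h 0%N < h 2%N by rewrite lt.
  have w43 : w 4%N < w 3%N by rewrite -lt //; clear -h02 e5 e6; lra.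
  have w65 : w 6%N < w 5%N by rewrite -lt //; clear -h02 e3 e4; lra.
  by clear -lt20 w43 w65 e1 e2; lra.
Qed.

(** If the base u of a tile of area A and height a is cut into the bases of two tiles of
    area A and heights b and c, then 1 / a = 1 / b + 1 / c. *)
Lemma harmonic (A u v w a b c : R) : A != 0 ->
  u * a = A -> v * b = A -> w * c = A -> u = v + w -> b * c = a * (b + c).
Proof.
move=> A0 ua vb wc uE; apply: (mulfI A0).
transitivity (v * b * a * c + w * c * a * b); last by rewrite vb wc; ring.
by rewrite -{1}ua uE; ring.
Qed.

(** P and s are the heights of the two tiles along the top side, and q the height of
    the middle tile along the bottom side. Eliminating q and s, where s (7 P - 1) =
    P, leaves a polynomial equation in P; its root 2 / 7 would give s = 2 / 7 < 1 /
    2, and its root (7 + sqrt 19) / 15 is larger than 1 / 2. *)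
Lemma spiral_height (P s q : R) : 0 < P -> P < 1 / 2%:R -> 1 / 2%:R < s ->
  P * s = 7%:R^-1 * (P + s) ->
  (1 - P) * (1 - P - q) = P * (1 - P + (1 - P - q)) ->
  (q - (1 - s)) * s = (1 - s) * (q - (1 - s) + s) ->
  P = (7%:R - Num.sqrt 19) / 15%:R.
Proof.
move=> P0 P_half s_half E1 E2 E3.
have E2' : q * (1 - 2%:R * P) = (1 - P) * (1 - 3%:R * P) by clear -E2; lra.
have E3' : q * (2%:R * s - 1) = (1 - s) * (3%:R * s - 1) by clear -E3; lra.
have E : (1 - P) * (1 - 3%:R * P) * (2%:R * s - 1) =
         (1 - s) * (3%:R * s - 1) * (1 - 2%:R * P).
  by rewrite -E2' -E3'; ring.
have sD : s * (7%:R * P - 1) = P by clear -E1; lra.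
have quartic : P * (7%:R * P - 2%:R) * (15%:R * P ^+ 2 - 14%:R * P + 2%:R) = 0.
  have e2 : (2%:R * s - 1) * (7%:R * P - 1) = 1 - 5%:R * P by rewrite mulrBl -mulrA sD; ring.
  have e3 : (1 - s) * (7%:R * P - 1) = 6%:R * P - 1 by rewrite mulrBl sD; ring.
  have e4 : (3%:R * s - 1) * (7%:R * P - 1) = 1 - 4%:R * P by rewrite mulrBl -mulrA sD; ring.
  have H : (1 - P) * (1 - 3%:R * P) * ((2%:R * s - 1) * (7%:R * P - 1)) * (7%:R * P - 1) =
      (1 - s) * (7%:R * P - 1) * ((3%:R * s - 1) * (7%:R * P - 1)) * (1 - 2%:R * P).
    transitivity ((1 - P) * (1 - 3%:R * P) * (2%:R * s - 1) * (7%:R * P - 1) ^+ 2); first by ring.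
    by rewrite E; ring.
  by rewrite e2 e3 e4 in H; clear -H; lra.
have quadratic : 15%:R * P ^+ 2 - 14%:R * P + 2%:R = 0.
  move/eqP: quartic; rewrite !mulf_eq0 (gt_eqF P0) /= => /orP[/eqP P27|/eqP //].
  have PE : P = 2%:R / 7%:R by clear -P27; lra.
  by exfalso; rewrite PE in sD; clear -sD s_half; lra.
have : (15%:R * P - 7%:R - Num.sqrt 19) * (15%:R * P - 7%:R + Num.sqrt 19) = 0.
  transitivity (15%:R * (15%:R * P ^+ 2 - 14%:R * P + 2%:R) + (19%:R - Num.sqrt 19 ^+ 2)).
    by ring.
  by rewrite quadratic sqrt19_sq mulr0 add0r subrr.
have [t1 _] := sqrt19_bounds.
by move/eqP; rewrite mulf_eq0 => /orP[] /eqP; clear -t1 P_half; lra.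
Qed.

(** The equations of the spiral layout in the unit square: w k and h k are the width
    and the height of the k-th tile. The six values found are the coordinates of the
    inner lines, from left to right and from bottom to top. *)
Lemma spiral_solution (w h : nat -> R) :
  let t := Num.sqrt 19 in
  (forall k, (k < 7)%N -> [/\ 0 < w k, 0 < h k & w k * h k = 7%:R^-1]) ->
  [/\ w 0%N + w 1%N + w 2%N = 1, w 0%N + w 5%N = w 6%N, w 6%N + w 4%N = 1 & w 3%N + w 4%N = w 2%N] ->
  [/\ h 0%N + h 6%N = 1, h 1%N + h 5%N = h 0%N, h 2%N + h 4%N = 1 & h 2%N + h 3%N = h 1%N] ->
  [/\ w 0%N = (8%:R - t) / 21%:R, w 0%N + w 1%N = (13%:R - t) / 21%:R & w 6%N = (7%:R + t) / 14%:R] /\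
  [/\ h 2%N = (8%:R - t) / 15%:R, h 1%N = 3%:R / 5%:R & h 0%N = (8%:R + t) / 15%:R].
Proof.
move=> t wh [x1 x2 x3 x4] [y1 y2 y3 y4].
have A0 : 0 < 7%:R^-1 :> R by rewrite invr_gt0.
have Anz : 7%:R^-1 != 0 :> R by rewrite gt_eqF.
have area k : (k < 7)%N -> w k * h k = 7%:R^-1 by move=> /wh[].
have lt i j : (i < 7)%N -> (j < 7)%N -> w j < w i -> h i < h j.
  move=> /wh[wi _ ai] /wh[wj _ aj].
  by rewrite (equal_area_lt wi wj A0 ai aj).
have w3p : 0 < w 3%N by case: (wh 3%N).
have w5p : 0 < w 5%N by case: (wh 5%N).
have h6p : 0 < h 6%N by case: (wh 6%N).
have P_half : h 6%N < 1 / 2%:R.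
  have : h 6%N < h 0%N by apply: lt => //; clear -x2 w5p; lra.
  by clear -y1; lra.
have s_half : 1 / 2%:R < h 4%N.
  have : h 2%N < h 4%N by apply: lt => //; clear -x4 w3p; lra.
  by clear -y3; lra.
have h0P : h 0%N = 1 - h 6%N by clear -y1; lra.
have h2P : h 2%N = 1 - h 4%N by clear -y3; lra.
have h5P : h 5%N = 1 - h 6%N - h 1%N by clear -y2 h0P; lra.
have h3P : h 3%N = h 1%N - (1 - h 4%N) by clear -y4 h2P; lra.
have E1 : h 6%N * h 4%N = 7%:R^-1 * (h 6%N + h 4%N).
  apply: (harmonic Anz (mul1r _) (area 6%N isT) (area 4%N isT)); exact/esym.
have E2 := harmonic Anz (area 6%N isT) (area 0%N isT) (area 5%N isT) (esym x2).
have E3 := harmonic Anz (area 2%N isT) (area 3%N isT) (area 4%N isT) (esym x4).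
rewrite h0P h5P in E2; rewrite h2P h3P in E3.
have h6E : h 6%N = (7%:R - t) / 15%:R := spiral_height h6p P_half s_half E1 E2 E3.
have tt : t ^+ 2 = 19%:R := sqrt19_sq.
have [t1 t2] := sqrt19_bounds; rewrite -/t in t1 t2.
have h0E : h 0%N = (8%:R + t) / 15%:R by clear -h0P h6E; lra.
have div k c d : (k < 7)%N -> h k = c -> c * d = 7%:R^-1 -> w k = d.
  move=> k7 hk cd; have [_ hp _] := wh k k7; apply: (@mulIf _ (h k)); first by rewrite gt_eqF.
  by rewrite area // hk mulrC.
have w6E : w 6%N = (7%:R + t) / 14%:R.
  apply: div h6E _ => //; transitivity ((49%:R - t ^+ 2) / 210%:R); first by field.
  by rewrite tt; field.
have w0E : w 0%N = (8%:R - t) / 21%:R.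
  apply: div h0E _ => //; transitivity ((64%:R - t ^+ 2) / 315%:R); first by field.
  by rewrite tt; field.
have h1E : h 1%N = 3%:R / 5%:R.
  have nz : 1 - 2%:R * h 6%N != 0 by rewrite gt_eqF //; clear -P_half; lra.
  apply: (mulIf nz).
  transitivity ((1 - h 6%N) * (1 - 3%:R * h 6%N)); first by clear -E2; lra.
  rewrite h6E; transitivity ((t ^+ 2 + 6%:R * t - 16%:R) / 75%:R); first by field.
  by rewrite tt; field.
have w1E : w 1%N = 5%:R / 21%:R by apply: div h1E _ => //; field.
have w4E : w 4%N = (7%:R - t) / 14%:R by clear -x3 w6E; lra.
have h4E : h 4%N = (7%:R + t) / 15%:R.
  have [w4p _ _] := wh 4%N isT; apply: (@mulfI _ (w 4%N)); first by rewrite gt_eqF.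
  rewrite area // w4E; transitivity ((49%:R - t ^+ 2) / 210%:R); last by field.
  by rewrite tt; field.
have h2E : h 2%N = (8%:R - t) / 15%:R by clear -h2P h4E; lra.
by split; split => //; rewrite w0E w1E; field.
Qed.

End Algebra.

(** * Symmetries of a square *)

Section Symmetries.
Variables (R : realType) (S : rectangle R).
Hypothesis squareS : is_square S.
Implicit Types (e : symmetry) (r : rectangle R).

(** The symmetry of the square S denoted by e, as a map of the plane. *)
Definition sym_map e (p : R * R) : R * R :=
  let: (s, gx, gy) := e in
  let p := if s then (xmin S + (p.2 - ymin S), ymin S + (p.1 - xmin S)) else p in
  (if gx then xmin S + xmax S - p.1 else p.1, if gy then ymin S + ymax S - p.2 else p.2).

Definition sym_inv e : symmetry :=
  let: (s, gx, gy) := e in (s, if s then gy else gx, if s then gx else gy).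

Lemma sym_mapK e : cancel (sym_map e) (sym_map (sym_inv e)).
Proof.
move=> [x y]; have := squareS; rewrite /is_square /width /height => sq.
by case: e => [[[] []] []]; rewrite /sym_map /=; congr pair; clear -sq; lra.
Qed.

Lemma sym_invK e : sym_inv (sym_inv e) = e.
Proof. by case: e => [[[] []] []]. Qed.

Lemma sym_map_isometry e p q : sqdist (sym_map e p) (sym_map e q) = sqdist p q.
Proof. by case: e => [[[] []] []]; rewrite /sqdist /sym_map /=; ring. Qed.

Lemma transpose_ltx r : xmin S + (ymin r - ymin S) < xmin S + (ymax r - ymin S).
Proof. by rewrite ltrD2l ltrD2r ymin_lt_ymax. Qed.
Lemma transpose_lty r : ymin S + (xmin r - xmin S) < ymin S + (xmax r - xmin S).
Proof. by rewrite ltrD2l ltrD2r xmin_lt_xmax. Qed.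
Lemma reflect_ltx r : xmin S + xmax S - xmax r < xmin S + xmax S - xmin r.
Proof. by rewrite ltrD2l ltrN2 xmin_lt_xmax. Qed.
Lemma reflect_lty r : ymin S + ymax S - ymax r < ymin S + ymax S - ymin r.
Proof. by rewrite ltrD2l ltrN2 ymin_lt_ymax. Qed.

(** The image of a rectangle under [sym_map]. *)
Definition sym_rect e r : rectangle R :=
  let: (s, gx, gy) := e in
  let r1 := if s then Rectangle (transpose_ltx r) (transpose_lty r) else r in
  let r2 := if gx then Rectangle (reflect_ltx r1) (ymin_lt_ymax r1) else r1 in
  if gy then Rectangle (xmin_lt_xmax r2) (reflect_lty r2) else r2.

Lemma region_sym_rect e r p : region r p -> region (sym_rect e r) (sym_map e p).
Proof.
case: p => x y /regionP[x1 x2 y1 y2].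
by case: e => [[[] []] []]; rewrite /sym_map /=; apply/regionP => /=; split;
  clear -x1 x2 y1 y2; lra.
Qed.

Lemma eq_region (r1 r2 : rectangle R) : xmin r1 = xmin r2 -> xmax r1 = xmax r2 ->
  ymin r1 = ymin r2 -> ymax r1 = ymax r2 -> region r1 = region r2.
Proof. by rewrite /region => -> -> -> ->. Qed.

Lemma sym_rectK e r : region (sym_rect (sym_inv e) (sym_rect e r)) = region r.
Proof.
have := squareS; rewrite /is_square /width /height => sq.
by case: e => [[[] []] []]; apply: eq_region => /=; clear -sq; lra.
Qed.

Lemma image_sym_map e r : sym_map e @` region r = region (sym_rect e r).
Proof.
apply/seteqP; split => [_ [p rp <-]|q rq]; first exact: region_sym_rect.
exists (sym_map (sym_inv e) q); last by rewrite -{1}[e]sym_invK sym_mapK.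
by rewrite -(sym_rectK e); apply: region_sym_rect.
Qed.

Lemma sym_rect_coordinates e :
  [/\ xmin (sym_rect e S) = xmin S, xmax (sym_rect e S) = xmax S,
      ymin (sym_rect e S) = ymin S & ymax (sym_rect e S) = ymax S].
Proof.
have := squareS; rewrite /is_square /width /height => sq.
by case: e => [[[] []] []] /=; split; clear -sq; lra.
Qed.

Lemma sym_map_symmetry e : is_symmetry S (sym_map e).
Proof.
split; first exact: sym_map_isometry.
by rewrite image_sym_map; have [? ? ? ?] := sym_rect_coordinates e; apply: eq_region.
Qed.

Lemma sym_rect_width e r : width (sym_rect e r) = if e.1.1 then height r else width r.
Proof. by case: e => [[[] []] []]; rewrite /width /height /=; ring. Qed.

Lemma sym_rect_height e r : height (sym_rect e r) = if e.1.1 then width r else height r.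
Proof. by case: e => [[[] []] []]; rewrite /width /height /=; ring. Qed.

(** The values of the names of abscissas after applying [orient]; if e exchanges the
    coordinates these are names of ordinates. *)
Definition sym_x e (vx vy : nat -> R) (u : nat) : R :=
  let c := if e.1.1 then xmin S + (vy u - ymin S) else vx u in
  if e.1.2 then xmin S + xmax S - c else c.

Definition sym_y e (vx vy : nat -> R) (u : nat) : R :=
  let c := if e.1.1 then ymin S + (vx u - xmin S) else vy u in
  if e.2 then ymin S + ymax S - c else c.

Lemma fits_sym e vx vy t r : fits vx vy t r ->
  fits (sym_x e vx vy) (sym_y e vx vy) (orient e t) (sym_rect e r).
Proof.
case: t => [[a b] [c d]] /and4P[/= /eqP e1 /eqP e2 /eqP e3 /eqP e4].
by case: e => [[[] []] []]; rewrite /fits /= /sym_x /sym_y /= e1 e2 e3 e4 !eqxx.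
Qed.

End Symmetries.

(** * Classification and existence *)

Section Layouts.
Variables (R : realType) (S : rectangle R).
Hypothesis squareS : is_square S.

Lemma width_gt0 (r : rectangle R) : 0 < width r.
Proof. by rewrite subr_gt0 xmin_lt_xmax. Qed.

Lemma height_gt0 (r : rectangle R) : 0 < height r.
Proof. by rewrite subr_gt0 ymin_lt_ymax. Qed.

Lemma fit_all_nth P vx vy ts idx j : fit_all P vx vy ts idx -> (j < size ts)%N ->
  fits vx vy (nth tile0 ts j) (P (nth ord0 idx j) : rectangle R).
Proof.
elim: ts idx j => [|t ts IHts] [|i idx] // [|j] /= /andP[fit fits_ts] //.
exact: IHts.
Qed.

(** A tiling described by a state that matches a layout is, after a symmetry and a
    renumbering of its tiles, a realization of this layout. *)
Lemma matches_sound (P : 'I_7 -> rectangle R) vx vy idx st layout m :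
  is_partition S P -> size layout = 7%N -> matches layout st m ->
  realizes S P vx vy idx st ->
  exists e (f : 'I_7 -> 'I_7) U V, [/\ injective f,
    fits U V (0, 4, (0, 4))%N S &
    forall k : 'I_7, fits U V (nth tile0 layout k) (sym_rect S e (P (f k)))].
Proof.
move=> partP szl; case: m => [[[e pi] rx] ry].
case: st => ts [|[[[|[|?]] top] []] [|? ?]] //= /and4P[/eqP sz perm /eqP wall /eqP lab] real.
have topE := finished_top partP real sz.
have [x0 x1 y0 us fit _] := real.
have szi : size idx = 7%N by move: fit; rewrite /fit_all all2E sz => /andP[/eqP].
have szp : size pi = 7%N by rewrite (perm_size perm).
have pi_lt k : (k < 7)%N -> (nth 0%N pi k < 7)%N.
  move=> k7; have : nth 0%N pi k \in iota 0 7 by rewrite -(perm_mem perm) mem_nth ?szp.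
  by rewrite mem_iota.
exists e, (fun k => nth ord0 idx (nth 0%N pi k)).
exists (fun u => sym_x S e vx vy (nth 0%N rx u)), (fun u => sym_y S e vx vy (nth 0%N ry u)).
split=> [k l /eqP||k].
- rewrite nth_uniq ?szi ?pi_lt // nth_uniq ?szp // ?(perm_uniq perm) ?iota_uniq //.
  by move=> /eqP/val_inj.
- have : fits vx vy (0, 1, (0, top))%N S by rewrite /fits /= x0 x1 y0 topE !eqxx.
  move=> /(fits_sym S e); rewrite wall; move: (sym_rect_coordinates squareS e).
  by rewrite /fits /= => -[-> -> -> ->].
have := congr1 (fun s => nth tile0 s k) lab.
rewrite (nth_map 0%N) ?szp // (nth_map tile0) ?szl // => labk.
have jlt := pi_lt k (ltn_ord k).
have := fit_all_nth fit; rewrite [size _]/= sz => /(_ _ jlt) /(fits_sym S e).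
by rewrite [(ts, _).1]/= labk.
Qed.

Lemma mirror_congruent (Q : 'I_7 -> rectangle R) U V :
  fits U V (0, 4, (0, 4))%N S -> (forall k : 'I_7, fits U V (nth tile0 mirror k) (Q k)) ->
  (forall k, area (Q k) = 7%:R^-1 * area S) ->
  congruent (Q (inord 0)) (Q (inord 2)).
Proof.
move=> /and4P[_ _ /= /eqP V0 /eqP V4] fit ar.
pose w k := U (nth tile0 mirror k).1.2 - U (nth tile0 mirror k).1.1.
pose h k := V (nth tile0 mirror k).2.2 - V (nth tile0 mirror k).2.1.
have wE (k : 'I_7) : w k = width (Q k).
  by have /and4P[/eqP e1 /eqP e2 _ _] := fit k; rewrite /width e1 e2.
have hE (k : 'I_7) : h k = height (Q k).
  by have /and4P[_ _ /eqP e1 /eqP e2] := fit k; rewrite /height e1 e2.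
have A0 : 0 < 7%:R^-1 * area S by rewrite mulr_gt0 ?invr_gt0 // mulr_gt0 ?width_gt0 ?height_gt0.
have wh k : (k < 7)%N -> 0 < w k /\ w k * h k = 7%:R^-1 * area S.
  move=> k7; have := ar (Ordinal k7); rewrite /area -wE -hE => ->.
  by rewrite (wE (Ordinal k7)) width_gt0.
have w02 : w 0%N = w 2%N.
  by apply: (mirror_equal_widths (L := height S) A0 wh);
    rewrite /w /h /height /= ?V0 ?V4; ring.
have h02 : h 0%N = h 2%N.
  have [_ a0] := wh 0%N isT; have [_ a2] := wh 2%N isT.
  by apply: equal_area_side a0 a2 w02; rewrite gt_eqF.
by left; rewrite -!wE -!hE !inordK.
Qed.

(** The vertical lines of the spiral partition, from left to right. *)
Definition spiral_x (i : nat) : R := xmin S + width S *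
  nth 0 [:: 0; (8%:R - Num.sqrt 19) / 21%:R; (13%:R - Num.sqrt 19) / 21%:R;
            (7%:R + Num.sqrt 19) / 14%:R; 1] i.

(** The horizontal lines of the spiral partition, from bottom to top. *)
Definition spiral_y (j : nat) : R := ymin S + height S *
  nth 0 [:: 0; (8%:R - Num.sqrt 19) / 15%:R; 3%:R / 5%:R; (8%:R + Num.sqrt 19) / 15%:R; 1] j.

Lemma spiral_x_lt i j : (i < j < 5)%N -> spiral_x i < spiral_x j.
Proof.
have [t1 t2] := sqrt19_bounds R.
move=> ij5; rewrite ltrD2l ltr_pM2l ?width_gt0 //; move: ij5.
by move=> /andP[]; case: j => [|[|[|[|[|j]]]]]; case: i => [|[|[|[|i]]]] //= _ _;
  clear -t1 t2; lra.
Qed.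

Lemma spiral_y_lt i j : (i < j < 5)%N -> spiral_y i < spiral_y j.
Proof.
have [t1 t2] := sqrt19_bounds R.
move=> ij5; rewrite ltrD2l ltr_pM2l ?height_gt0 //; move: ij5.
by move=> /andP[]; case: j => [|[|[|[|[|j]]]]]; case: i => [|[|[|[|i]]]] //= _ _;
  clear -t1 t2; lra.
Qed.

Lemma spiral_wf (k : 'I_7) : let t := nth tile0 spiral k in
  (t.1.1 < t.1.2 < 5)%N /\ (t.2.1 < t.2.2 < 5)%N.
Proof. by case: k => [[|[|[|[|[|[|[|k]]]]]]]]. Qed.

(** The tiles of the spiral partition. *)
Definition spiral_rect (k : 'I_7) : rectangle R :=
  Rectangle (spiral_x_lt (spiral_wf k).1) (spiral_y_lt (spiral_wf k).2).

Lemma spiral_unique (Q : 'I_7 -> rectangle R) U V :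
  fits U V (0, 4, (0, 4))%N S -> (forall k : 'I_7, fits U V (nth tile0 spiral k) (Q k)) ->
  (forall k, area (Q k) = 7%:R^-1 * area S) ->
  forall k, region (Q k) = region (spiral_rect k).
Proof.
move=> /and4P[/= /eqP U0 /eqP U4 /eqP V0 /eqP V4] fit ar.
have W0 := width_gt0 S; have H0 := height_gt0 S.
have Wn : width S != 0 by rewrite gt_eqF.
have Hn : height S != 0 by rewrite gt_eqF.
pose u i := (U i - xmin S) / width S; pose v i := (V i - ymin S) / height S.
have u0 : u 0%N = 0 by rewrite /u U0 subrr mul0r.
have u4 : u 4%N = 1 by rewrite /u -U4 divff.
have v0 : v 0%N = 0 by rewrite /v V0 subrr mul0r.
have v4 : v 4%N = 1 by rewrite /v -V4 divff.
pose w k := u (nth tile0 spiral k).1.2 - u (nth tile0 spiral k).1.1.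
pose h k := v (nth tile0 spiral k).2.2 - v (nth tile0 spiral k).2.1.
have wE (k : 'I_7) : w k = width (Q k) / width S.
  have /and4P[/eqP e1 /eqP e2 _ _] := fit k.
  by rewrite [width (Q k)]/width e1 e2 /w /u -mulrBl; congr (_ / _); ring.
have hE (k : 'I_7) : h k = height (Q k) / height S.
  have /and4P[_ _ /eqP e1 /eqP e2] := fit k.
  by rewrite [height (Q k)]/height e1 e2 /h /v -mulrBl; congr (_ / _); ring.
have wh k : (k < 7)%N -> [/\ 0 < w k, 0 < h k & w k * h k = 7%:R^-1].
  move=> k7; rewrite (wE (Ordinal k7)) (hE (Ordinal k7)).
  rewrite !divr_gt0 ?width_gt0 ?height_gt0 //; split=> //.
  rewrite mulrACA -invfM -/(area S) -/(area (Q _)) ar mulfK //.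
  by rewrite mulf_neq0.
have [||[w0E w1E w6E] [h2E h1E h0E]] := spiral_solution wh.
- by rewrite /w /= u0 u4; split; ring.
- by rewrite /h /= v0 v4; split; ring.
rewrite /w /h /= !(u0, v0, u4, v4) in w0E w1E w6E h2E h1E h0E.
have UE i : (i < 5)%N -> U i = spiral_x i.
  move=> i5; have -> : U i = xmin S + width S * u i.
    by rewrite /u mulrC divfK // addrC subrK.
  rewrite /spiral_x; congr (_ + _ * _).
  by case: i i5 => [|[|[|[|[|i]]]]] //= _; [clear -w0E | clear -w0E w1E | clear -w6E]; lra.
have VE i : (i < 5)%N -> V i = spiral_y i.
  move=> i5; have -> : V i = ymin S + height S * v i.
    by rewrite /v mulrC divfK // addrC subrK.
  rewrite /spiral_y; congr (_ + _ * _).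
  by case: i i5 => [|[|[|[|[|i]]]]] //= _; [clear -h2E | clear -h1E | clear -h0E]; lra.
move=> k; have /and4P[/eqP e1 /eqP e2 /eqP e3 /eqP e4] := fit k.
have [/andP[a1 a2] /andP[b1 b2]] := spiral_wf k.
have a3 := ltn_trans a1 a2; have b3 := ltn_trans b1 b2.
by apply: eq_region; rewrite ?e1 ?e2 ?e3 ?e4 ?UE ?VE.
Qed.

(** Up to a symmetry and a renumbering, the spiral partition is the only proper perfect
    Mondrian 7-partition. *)
Lemma spiral_classification (P : 'I_7 -> rectangle R) : proper_perfect_mondrian S P ->
  exists e (f : 'I_7 -> 'I_7), injective f /\
    forall k, sym_map S e @` region (P (f k)) = region (spiral_rect k).
Proof.
move=> [partP mondP perfP propP].
have [st /run_start st_ok [vx [vy [idx real]]]] := run_sound partP propP 9%N (start_realized S P).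
have area_sym e k : area (sym_rect S e (P k)) = 7%:R^-1 * area S.
  by rewrite -(perfP k) /area sym_rect_width sym_rect_height; case: ifP => // _; rewrite mulrC.
case/orP: st_ok => /hasP[m _ mm].
  have [e [f [U [V [finj fS fit]]]]] := matches_sound partP (erefl : size spiral = 7%N) mm real.
  exists e, f; split=> // k; rewrite image_sym_map //.
  by apply: (spiral_unique fS fit) => l; apply: area_sym.
have [e [f [U [V [finj fS fit]]]]] := matches_sound partP (erefl : size mirror = 7%N) mm real.
have /= := mirror_congruent fS fit (fun k => area_sym e (f k)).
rewrite /congruent !sym_rect_width !sym_rect_height => cong.
case: (mondP (f (inord 0)) (f (inord 2))).
  by rewrite (inj_eq finj) -val_eqE /= !inordK.
by rewrite /congruent; move: cong; case: ifP => // _ [[? ?]|[? ?]]; [left | right].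
Qed.

Lemma spiral_related (P Q : 'I_7 -> rectangle R) :
  proper_perfect_mondrian S P -> proper_perfect_mondrian S Q -> related_by_symmetry S P Q.
Proof.
move=> /spiral_classification[eP [fP [injP imP]]] /spiral_classification[eQ [fQ [injQ imQ]]].
pose F := sym_map S (sym_inv eQ) \o sym_map S eP.
have FE k : F @` region (P (fP k)) = region (Q (fQ k)).
  rewrite -image_comp imP -imQ image_comp.
  rewrite (_ : _ \o _ = id) ?image_id //; apply/funext => p /=; exact: sym_mapK.
have [gP fPK gPK] := injF_bij injP; have [gQ fQK gQK] := injF_bij injQ.
exists F.
  split=> [p q|]; first by rewrite /F /= !sym_map_isometry.
  by rewrite -image_comp (sym_map_symmetry squareS _).2 (sym_map_symmetry squareS _).2.
apply/seteqP; split => [_ [i _ <-]|_ [i _ <-]].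
  by exists (fQ (gP i)) => //; rewrite -FE gPK.
by exists (fP (gQ i)) => //; rewrite FE gQK.
Qed.

(** The lines of the spiral partition cut the square into sixteen half-open cells,
    on which membership in the tiles is decided by the indices of the lines. *)
Lemma grid_column (g : nat -> R) x : g 0%N <= x < g 4%N ->
  exists2 i, (i < 4)%N & g i <= x < g i.+1.
Proof.
move=> /andP[x0 x4]; case: (ltP x (g 1%N)) => x1; first by exists 0%N => //; rewrite x0.
case: (ltP x (g 2%N)) => x2; first by exists 1%N => //; rewrite x1.
case: (ltP x (g 3%N)) => x3; first by exists 2%N => //; rewrite x2.
by exists 3%N => //; rewrite x3.
Qed.

Lemma grid_le (g : nat -> R) i a x :
  (forall i j, (i < j < 5)%N -> g i < g j) -> (i < 4)%N -> (a < 5)%N ->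
  g i <= x < g i.+1 -> (g a <= x) = (a <= i)%N.
Proof.
move=> g_lt i4 a5 /andP[ix xi]; case: (leqP a i) => ai.
  apply: le_trans ix; move: ai; rewrite leq_eqVlt => /predU1P[-> //|ai].
  by apply/ltW/g_lt; rewrite ai (leq_trans i4).
apply/negbTE; rewrite -ltNge; apply: (lt_le_trans xi).
by move: ai; rewrite leq_eqVlt => /predU1P[-> //|ai]; apply/ltW/g_lt; rewrite ai.
Qed.

Lemma inside_spiral i j x y k : (i < 4)%N -> (j < 4)%N ->
  spiral_x i <= x < spiral_x i.+1 -> spiral_y j <= y < spiral_y j.+1 ->
  inside (spiral_rect k) x y = in_cell i j (nth tile0 spiral k).
Proof.
move=> i4 j4 xi yj; have [/andP[a1 a2] /andP[b1 b2]] := spiral_wf k.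
have a3 := ltn_trans a1 a2; have b3 := ltn_trans b1 b2.
rewrite /inside /in_cell /=.
rewrite (grid_le spiral_x_lt i4 a3 xi) (grid_le spiral_y_lt j4 b3 yj).
by rewrite !ltNge (grid_le spiral_x_lt i4 a2 xi) (grid_le spiral_y_lt j4 b2 yj) -!ltnNge.
Qed.

Lemma spiral_x0 : spiral_x 0 = xmin S. Proof. by rewrite /spiral_x /= mulr0 addr0. Qed.
Lemma spiral_x4 : spiral_x 4 = xmax S.
Proof. by rewrite /spiral_x /= mulr1 addrC subrK. Qed.
Lemma spiral_y0 : spiral_y 0 = ymin S. Proof. by rewrite /spiral_y /= mulr0 addr0. Qed.
Lemma spiral_y4 : spiral_y 4 = ymax S.
Proof. by rewrite /spiral_y /= mulr1 addrC subrK. Qed.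

Lemma inside_cell x y : inside S x y -> exists ij,
  [/\ (ij.1 < 4)%N, (ij.2 < 4)%N, spiral_x ij.1 <= x < spiral_x ij.1.+1 &
      spiral_y ij.2 <= y < spiral_y ij.2.+1].
Proof.
rewrite /inside -spiral_x0 -spiral_x4 -spiral_y0 -spiral_y4.
by move=> /andP[/grid_column[i i4 xi] /grid_column[j j4 yj]]; exists (i, j).
Qed.

Lemma spiral_inside k x y : inside (spiral_rect k) x y -> inside S x y.
Proof.
have [/andP[a1 a2] /andP[b1 b2]] := spiral_wf k.
have le_x i j : (i <= j < 5)%N -> spiral_x i <= spiral_x j.
  by rewrite leq_eqVlt => /andP[/predU1P[-> //|ij j5]]; apply/ltW/spiral_x_lt/andP.
have le_y i j : (i <= j < 5)%N -> spiral_y i <= spiral_y j.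
  by rewrite leq_eqVlt => /andP[/predU1P[-> //|ij j5]]; apply/ltW/spiral_y_lt/andP.
move=> /insideP[/= x1 x2 y1 y2]; apply/insideP.
rewrite -spiral_x0 -spiral_x4 -spiral_y0 -spiral_y4; split.
- by apply: le_trans x1; apply: le_x; rewrite /= (ltn_trans a1).
- by apply: lt_le_trans x2 _; apply: le_x; rewrite -ltnS a2.
- by apply: le_trans y1; apply: le_y; rewrite /= (ltn_trans b1).
- by apply: lt_le_trans y2 _; apply: le_y; rewrite -ltnS b2.
Qed.

Lemma spiral_disjoint k l x y :
  inside (spiral_rect k) x y -> inside (spiral_rect l) x y -> k = l.
Proof.
move=> kxy; have [[i j] [/= i4 j4 xi yj]] := inside_cell (spiral_inside kxy).
have [u _ uniq_u] := spiral_cells i4 j4; move: kxy.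
by rewrite !(inside_spiral _ i4 j4 xi yj) => /uniq_u -> /uniq_u ->.
Qed.

Lemma spiral_partition : is_partition S spiral_rect.
Proof.
apply: partition_of_inside => // [x y /inside_cell[[i j] [/= i4 j4 xi yj]]|k x y|k l x y].
- have [u uc _] := spiral_cells i4 j4; exists u.
  by rewrite (inside_spiral _ i4 j4 xi yj).
- exact: spiral_inside.
- exact: spiral_disjoint.
Qed.

(** A rectangle which is the union of the tiles indexed by I contains their bounding
    box; if I is neither a singleton nor everything, this box overlaps another tile.
    *)
Lemma spiral_proper : proper_partition S spiral_rect.
Proof.
move=> [I [r [szI _ rE]]].
pose m := [seq k \in I | k <- enum 'I_7].
have m7 : size m = 7%N by rewrite size_map size_enum_ord.
have cm : count id m = #|I| by rewrite count_map cardE size_filter -enumT.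
have := @spiral_hull m m7; rewrite cm => /(_ szI); rewrite /hull_meets.
rewrite -map_comp => /(has_mask_spiral (A := fun k => k \notin I))[k kI].
have sub l : l \in I -> region (spiral_rect l) `<=` region r.
  by move=> lI p lp; rewrite -rE; exists l.
have sel p : has p (mask m spiral) -> exists2 l : 'I_7, l \in I & p (nth tile0 spiral l).
  exact: (has_mask_spiral (A := fun k => k \in I)).
move=> /and4P[/sel[l1 l1I h1] /sel[l2 l2I h2] /sel[l3 l3I h3] /sel[l4 l4I h4]].
have [/andP[a1 a2] /andP[b1 b2]] := spiral_wf k.
have r1 : xmin r < xmax (spiral_rect k).
  have [le _ _ _] := region_sub (sub _ l1I).
  by apply: (le_lt_trans le); apply: spiral_x_lt; rewrite h1.
have r2 : xmin (spiral_rect k) < xmax r.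
  have [_ le _ _] := region_sub (sub _ l2I).
  by apply: lt_le_trans le; apply: spiral_x_lt; rewrite h2; case/andP: (spiral_wf l2).1.
have r3 : ymin r < ymax (spiral_rect k).
  have [_ _ le _] := region_sub (sub _ l3I).
  by apply: (le_lt_trans le); apply: spiral_y_lt; rewrite h3.
have r4 : ymin (spiral_rect k) < ymax r.
  have [_ _ _ le] := region_sub (sub _ l4I).
  by apply: lt_le_trans le; apply: spiral_y_lt; rewrite h4; case/andP: (spiral_wf l4).2.
pose x := Num.max (xmin r) (xmin (spiral_rect k)).
pose y := Num.max (ymin r) (ymin (spiral_rect k)).
have kxy : inside (spiral_rect k) x y.
  apply/insideP; rewrite !le_max !lexx !orbT !gt_max.
  by rewrite r1 r3 xmin_lt_xmax ymin_lt_ymax.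
have rxy : inside r x y.
  apply/insideP; rewrite !le_max !lexx !gt_max.
  by rewrite r2 r4 xmin_lt_xmax ymin_lt_ymax.
have [|l lI lxy] := @cover_inside R 7 spiral_rect (mem I) r x y _ rxy.
  by move=> p; rewrite -rE => -[l lI lp]; exists l.
by move: kI; rewrite (spiral_disjoint kxy lxy) => /negP; apply.
Qed.

(** The widths and heights of the tiles in the unit square. *)
Definition spiral_widths : seq R := let t := Num.sqrt 19 in
  [:: (8%:R - t) / 21%:R; 5%:R / 21%:R; (8%:R + t) / 21%:R; (5%:R * t - 5%:R) / 42%:R;
      (7%:R - t) / 14%:R; (5%:R + 5%:R * t) / 42%:R; (7%:R + t) / 14%:R].

Definition spiral_heights : seq R := let t := Num.sqrt 19 in
  [:: (8%:R + t) / 15%:R; 3%:R / 5%:R; (8%:R - t) / 15%:R; (t + 1) / 15%:R;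
      (7%:R + t) / 15%:R; (t - 1) / 15%:R; (7%:R - t) / 15%:R].

Lemma spiral_rect_width k : width (spiral_rect k) = width S * spiral_widths`_k.
Proof.
by case: k => [[|[|[|[|[|[|[|k]]]]]]]] //= ?; rewrite /width /= /spiral_x /width /=; field.
Qed.

Lemma spiral_rect_height k : height (spiral_rect k) = height S * spiral_heights`_k.
Proof.
by case: k => [[|[|[|[|[|[|[|k]]]]]]]] //= ?; rewrite /height /= /spiral_y /height /=; field.
Qed.

Lemma spiral_perfect : perfect S spiral_rect.
Proof.
move=> k; rewrite /area spiral_rect_width spiral_rect_height mulrACA mulrC; congr (_ * _).
have tt := sqrt19_sq R; set t := Num.sqrt 19 in tt.
by case: k => [[|[|[|[|[|[|[|k]]]]]]]] //= _; rewrite /spiral_widths /spiral_heights /= -/t;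
  clear -tt; lra.
Qed.

Lemma spiral_mondrian : mondrian spiral_rect.
Proof.
move=> k l kl; rewrite /congruent !spiral_rect_width !spiral_rect_height -squareS.
have W0 : width S != 0 by rewrite gt_eqF ?width_gt0.
have [t1 t2] := sqrt19_bounds R.
suff [ne1 ne2] : spiral_widths`_k <> spiral_widths`_l /\ spiral_widths`_k <> spiral_heights`_l.
  by case=> [[/(mulfI W0) e _]|[/(mulfI W0) e _]].
move: kl; case: k => [[|[|[|[|[|[|[|k]]]]]]]] //= ?; case: l => [[|[|[|[|[|[|[|l]]]]]]]] //= ? _;
  split; clear -t1 t2; lra.
Qed.

End Layouts.

Theorem proposition4p1 (R : realType) (S : rectangle R) (hS : is_square S) :
  (exists P : 'I_7 -> rectangle R, proper_perfect_mondrian S P) /\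
  (forall P Q : 'I_7 -> rectangle R,
     proper_perfect_mondrian S P -> proper_perfect_mondrian S Q ->
     related_by_symmetry S P Q).
Proof.
split; last exact: spiral_related.
exists (spiral_rect S); split.
- exact: spiral_partition.
- exact: spiral_mondrian.
- exact: spiral_perfect.
- exact: spiral_proper.
Qed.
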